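(* Fix $k\in\mathbb{N}$, positive constants $b_0,b_1,b_2,\lambda_0,\lambda_1$ and $\mu\in(0,1)$. There exists a constant $C>0$ depending only on $b_0,b_1,b_2,\lambda_0,\lambda_1,\mu$ (and the fixed $k$) such that the following holds. Let $T\geq 10$, $\ell<r$, $a^\pm\in\mathbb{R}^k$, let $g:[\ell,r]\to\mathbb{R}$ be Lipschitz with $g(\ell)=g(r)=0$, and let $P\subset(\ell,r)$ be finite. Suppose that $r-\ell\leq b_0T$, $|P|\leq b_0T$, $|g(x)-g(y)|\leq b_1T|x-y|$ for all $x,y\in[\ell,r]$, $a^\pm_j-a^\pm_{j+1}\geq\lambda_0T^{1/2}$ for all $j\in\{1,\dots,k-1\}$, $a^-_k-g(\ell)\geq\lambda_1T$, $a^+_k-g(r)\geq\lambda_1T$, $a^-_1-g(\ell)\leq b_2T^2$ and $a^+_1-g(r)\leq b_2T^2$. Then $\mathbb{P}_{\mathcal{L}}(\mathsf{H})\geq C^{-1}e^{-CT^{5/2}}$.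
   Context: For $\ell<r$ and $a^-=(a^-_1,\dots,a^-_k)$, $a^+=(a^+_1,\dots,a^+_k)\in\mathbb{R}^k$, $\mathbb{P}_{\mathrm{free}}$ denotes the law of $k$ independent Brownian bridges (diffusion parameter one) $\mathcal{L}=(\mathcal{L}_1,\dots,\mathcal{L}_k)$ on $[\ell,r]$ with $\mathcal{L}_j(\ell)=a^-_j$ and $\mathcal{L}_j(r)=a^+_j$. Given $g$ and a finite $P\subset(\ell,r)$, let $W(\mathcal{L})=1$ if $\mathcal{L}_j(p)>g(p)$ for all $p\in P$ and all $j\in\{1,\dots,k\}$, and $W(\mathcal{L})=0$ otherwise; $\mathbb{P}_{\mathcal{L}}$ is the probability measure with $\frac{d\mathbb{P}_{\mathcal{L}}}{d\mathbb{P}_{\mathrm{free}}}=W/\mathbb{E}_{\mathrm{free}}[W]$ (free bridges conditioned to be above $g$ at the points of $P$). For $\mu\in(0,1)$, $\mathsf{H}$ is the event that $\mathcal{L}_j(p)-\mathcal{L}_{j+1}(p)\geq\mu\lambda_0T^{1/2}$ for all $p\in P$ and $j\in\{1,\dots,k-1\}$, and $\mathcal{L}_k(p)-g(p)\geq\mu\lambda_1T$ for all $p\in P$. *)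

(* Defs.v *)
From HB Require Import structures.
From mathcomp Require Import all_boot all_order all_algebra.
From mathcomp Require Import all_classical all_reals all_analysis.
Set Implicit Arguments. Unset Strict Implicit. Unset Printing Implicit Defensive.
Import Order.TTheory GRing.Theory Num.Theory.
Local Open Scope ring_scope.

Section BB.
Variable R : realType.

Definition heat (t x y : R) : R :=
  expR (- (y - x) ^+ 2 / (2 * t)) / Num.sqrt (2 * pi * t).

(* Joint density of a Brownian bridge on [l,r] from am to ap, evaluated at
   the increasing times ts (all in (l,r)) with values ys (size ys = size ts). *)
Definition bridge_dens (l r am ap : R) (ts ys : seq R) : R :=
  let tt := l :: rcons ts r in
  let yy := am :: rcons ys ap in
  (\prod_(i < (size ts).+1)
     heat (nth 0 tt i.+1 - nth 0 tt i) (nth 0 yy i) (nth 0 yy i.+1))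
  / heat (r - l) am ap.

Fixpoint iint (n : nat) (F : (nat -> R) -> \bar R) : \bar R :=
  match n with
  | 0 => F (fun _ => 0)
  | n'.+1 => (\int[@lebesgue_measure R]_x
                iint n' (fun v => F (fun i => if i is i'.+1 then v i' else x)))%E
  end.

Definition sortedP (P : seq R) : seq R := sort <=%R P.

(* Value of curve j at the i-th point of P (sorted), variable layout v (j*m+i). *)
Definition curve_val (m : nat) (v : nat -> R) (j i : nat) : R := v (j * m + i).

(* Expectation under P_free (k independent Brownian bridges, curve j from
   am j at l to ap j at r) of a functional F depending only on the values of
   the curves at the points of P: integral against the finite-dimensional
   density of the bridges at the points of P. *)
Definition Efree (k : nat) (l r : R) (am ap : nat -> R) (P : seq R)
    (F : (nat -> R) -> R) : \bar R :=
  let ps := sortedP P in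
  let m := size ps in
  iint (k * m) (fun v =>
    ((F v) * \prod_(j < k)
        bridge_dens l r (am j) (ap j) ps (mkseq (curve_val m v j) m))%:E)%E.

Definition Wev (k : nat) (g : R -> R) (P : seq R) (v : nat -> R) : bool :=
  let ps := sortedP P in
  let m := size ps in
  [forall j : 'I_k, [forall i : 'I_m, g (nth 0 ps i) < curve_val m v j i]].

Definition Hev (k : nat) (g : R -> R) (P : seq R) (mu lam0 lam1 T : R)
    (v : nat -> R) : bool :=
  let ps := sortedP P in
  let m := size ps in
  [forall i : 'I_m,
    [forall j : 'I_k, (j.+1 < k)%N ==>
       (mu * lam0 * Num.sqrt T <= curve_val m v j i - curve_val m v j.+1 i)]
    && (mu * lam1 * T <= curve_val m v k.-1 i - g (nth 0 ps i))].

Definition indic (b : bool) : R := if b then 1 else 0.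

Definition probL_H (k : nat) (l r : R) (am ap : nat -> R) (g : R -> R)
    (P : seq R) (mu lam0 lam1 T : R) : R :=
  fine (Efree k l r am ap P
          (fun v => indic (Wev k g P v) * indic (Hev k g P mu lam0 lam1 T v)))
  / fine (Efree k l r am ap P (fun v => indic (Wev k g P v))).

End BB.

(* Main.v *)
Require Import Defs.
From HB Require Import structures.
From mathcomp Require Import all_boot all_order all_algebra.
From mathcomp Require Import all_classical all_reals all_analysis.
From mathcomp Require Import ring lra zify.
Import Order.TTheory GRing.Theory Num.Theory.
Local Open Scope ring_scope.

(** The curves are independent under the conditioned law, so everything reduces
    to one bridge. Let psi_j be the least concave function on the points
    l, P, r with the end values of curve j and psi_j >= g on P. Its slope only
    drops at points where psi_j = g, and its total slope drop is O(T) because g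
    is Lipschitz. Writing the curve as psi_j + z, the density of the bridge at
    psi_j + z is e^(-E_j) times that of a bridge from 0 to 0 at z times
    exp(- sum kappa z), where kappa >= 0 are the slope drops. If the curve lies
    above g, then z >= 0 wherever kappa > 0, so P_free(W) <= prod_j e^(-E_j).
    For the lower bound, curve j is confined to a tube around psi_j + h_j, where
    h_j is a multiple of a trapezoid of height O(T) and slopes O(T). These tubes
    are separated, and each costs a further exp(- O(T^2)). Thus the conditional
    probability of H is even at least exp(- C T^2). *)

(** * Integrals of nonnegative functions without measurability assumptions *)

Section Integral.
Context {d : measure_display} {T : measurableType d} {R : realType}.
Variable mu : {measure set T -> \bar R}.
Local Open Scope ereal_scope.
Import HBNNSimple.

(* The library integral of a nonnegative function is a supremum over simple
   functions, so monotonicity needs no measurability. *)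
Lemma le_integralT_ge0 (f g : T -> \bar R) :
  (forall x, 0 <= g x) -> (forall x, f x <= g x) ->
  \int[mu]_x f x <= \int[mu]_x g x.
Proof.
move=> g0 fg; rewrite (integralE _ _ f).
apply: (@le_trans _ _ (\int[mu]_x f^\+ x)).
  by rewrite geeDl// oppe_le0 integral_ge0.
rewrite !ge0_integralTE//.
apply: ge_ereal_sup => _ [h /= hf <-].
apply: ereal_sup_ubound; exists h => //= x; apply: (le_trans (hf x)).
by rewrite funeposE ge_max fg g0.
Qed.

Lemma ge0_integralZlT_le (f : T -> \bar R) (c : R) :
  (forall x, 0 <= f x) -> (0 < c)%R ->
  c%:E * \int[mu]_x f x <= \int[mu]_x (c%:E * f x).
Proof.
move=> f0 c0.
rewrite !ge0_integralTE// => [|x]; last by rewrite mule_ge0// lee_fin ltW.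
rewrite -lee_pdivlMl//.
apply: ge_ereal_sup => _ [h /= hf <-].
rewrite lee_pdivlMl// -sintegralrM.
apply: ereal_sup_ubound; exists (scale_nnsfun h (ltW c0)) => //= x.
by rewrite EFinM lee_pmul2l.
Qed.

(** The missing inequality is [ge0_integralZlT_le] for the factor 1/c and the function c f. *)
Lemma ge0_integralZlT (f : T -> \bar R) (c : R) :
  (forall x, 0 <= f x) -> (0 <= c)%R ->
  \int[mu]_x (c%:E * f x) = c%:E * \int[mu]_x f x.
Proof.
move=> f0; rewrite le_eqVlt => /predU1P[<-|c0].
  by rewrite mul0e; under eq_integral do rewrite mul0e; rewrite integral0.
apply/eqP; rewrite eq_le ge0_integralZlT_le// andbT.
rewrite -(@lee_pmul2l _ (c^-1)%R%:E) ?lte_fin ?invr_gt0//.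
rewrite [leRHS]muleA -EFinM mulVf ?gt_eqF// mul1e.
have -> : \int[mu]_x f x = \int[mu]_x (c^-1%:E * (c%:E * f x)).
  by apply: eq_integral => x _; rewrite muleA -EFinM mulVf ?gt_eqF// mul1e.
apply: ge0_integralZlT_le => [x|]; last by rewrite invr_gt0.
by rewrite mule_ge0// lee_fin ltW.
Qed.

End Integral.

(** * Monotonicity and scaling of iterated integrals *)

Section IteratedIntegral.
Context {R : realType}.
Implicit Types (F G : (nat -> R) -> \bar R).
Local Open Scope ereal_scope.

Definition vcons (x : R) (v : nat -> R) : nat -> R :=
  fun i => if i is i'.+1 then v i' else x.

Lemma iintS n F :
  iint n.+1 F = \int[@lebesgue_measure R]_x iint n (fun v => F (vcons x v)).
Proof. by []. Qed.

Lemma iint_ge0 n F : (forall v, 0 <= F v) -> 0 <= iint n F.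
Proof.
elim: n F => [|n IH] F F0 /=; first exact: F0.
by apply: integral_ge0 => x _; exact: IH.
Qed.

Lemma le_iint n F G : (forall v, 0 <= F v) -> (forall v, F v <= G v) ->
  iint n F <= iint n G.
Proof.
elim: n F G => [|n IH] F G F0 FG /=; first exact: FG.
apply: le_integralT_ge0 => x; last by apply: IH.
by apply: iint_ge0 => v; exact: le_trans (F0 _) (FG _).
Qed.

Lemma iintZl n (c : R) F : (0 <= c)%R -> (forall v, 0 <= F v) ->
  iint n (fun v => c%:E * F v) = c%:E * iint n F.
Proof.
move=> c0; elim: n F => [//|n IH] F F0 /=.
rewrite -ge0_integralZlT// => [|x]; last exact: iint_ge0.
by apply: eq_integral => x _; rewrite IH.
Qed.

End IteratedIntegral.

(** * Gaussian integrals of products of two heat kernels *)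

Section HeatKernel.
Context {R : realType}.
Implicit Types a b c s x y z : R.

Lemma heat_ge0 a x y : 0 <= heat a x y.
Proof. by rewrite divr_ge0 ?expR_ge0 ?sqrtr_ge0. Qed.

Lemma heat_gt0 a x y : 0 < a -> 0 < heat a x y.
Proof.
by move=> a0; rewrite divr_gt0 ?expR_gt0// sqrtr_gt0 !mulr_gt0 ?pi_gt0.
Qed.

(* Completing the square in y. *)
Lemma heat_mul_expR a b c s x y z : 0 < a -> 0 < b ->
  heat a x (y - s) * heat b (y - s) z * expR (c * (y - s)) =
  heat (a + b) x z *
    expR (c * ((b * x + a * z) / (a + b)) + c ^+ 2 * (a * b / (a + b)) / 2) *
  normal_pdf (s + ((b * x + a * z) / (a + b) + c * (a * b / (a + b))))
    (Num.sqrt (a * b / (a + b))) y.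
Proof.
move=> a0 b0; have ab0 : 0 < a + b by exact: addr_gt0.
have v0 : 0 < a * b / (a + b) by rewrite divr_gt0 ?mulr_gt0.
rewrite normal_pdfE ?gt_eqF ?sqrtr_gt0// /normal_peak /normal_fun /heat.
rewrite sqr_sqrtr; last exact: ltW.
have pi0 := pi_gt0 R.
have K : (Num.sqrt (2 * pi * a))^-1 * (Num.sqrt (2 * pi * b))^-1 =
  (Num.sqrt (2 * pi * (a + b)))^-1 *
  (Num.sqrt (a * b / (a + b) * pi *+ 2))^-1.
  rewrite -!invfM; congr (_^-1).
  rewrite -!sqrtrM ?mulr_ge0 ?ltW//; congr (Num.sqrt _).
  by rewrite -mulr_natr; field; rewrite gt_eqF.
transitivity ((Num.sqrt (2 * pi * a))^-1 * (Num.sqrt (2 * pi * b))^-1 *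
  expR (- (y - s - x) ^+ 2 / (2 * a) + - (z - (y - s)) ^+ 2 / (2 * b)
        + c * (y - s))).
  by rewrite !expRD; ring.
set u := _ + _ + c * _.
rewrite K.
set m := (b * x + a * z) / (a + b).
set v := a * b / (a + b).
have -> : u = - (z - x) ^+ 2 / (2 * (a + b)) + (c * m + c ^+ 2 * v / 2)
   + - (y - (s + (m + c * v))) ^+ 2 / (v *+ 2).
  rewrite /u /m /v -mulr_natr; field.
  by rewrite !gt_eqF//= mulr_gt0.
by rewrite !expRD; ring.
Qed.

Let heat_mul_integrable a b c s x z : 0 < a -> 0 < b ->
  (@lebesgue_measure R).-integrable setT (fun y =>
    (heat a x (y - s) * heat b (y - s) z * expR (c * (y - s)))%:E).
Proof.
move=> a0 b0; under eq_fun do rewrite heat_mul_expR// EFinM.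
by apply: integrableZl => //; exact: integrable_normal_pdf.
Qed.

Lemma integral_heat_mul_expR a b c s x z : 0 < a -> 0 < b ->
  (\int[@lebesgue_measure R]_y
    (heat a x (y - s) * heat b (y - s) z * expR (c * (y - s)))%:E =
  (heat (a + b) x z *
    expR (c * ((b * x + a * z) / (a + b)) +
          c ^+ 2 * (a * b / (a + b)) / 2))%:E)%E.
Proof.
move=> a0 b0; under eq_integral do rewrite heat_mul_expR// EFinM.
rewrite integralZl//; last exact: integrable_normal_pdf.
by rewrite integral_normal_pdf mule1.
Qed.

(** This is 2 e^C cosh(c x). With C = - c w it dominates the indicator of |x| > w, and unlike that
    indicator it keeps its form when integrated against heat kernels. *)
Definition twocosh c C x := expR (c * x + C) + expR (- c * x + C).

Lemma twocosh_ge1 c C x : 0 <= c * `|x| + C -> 1 <= twocosh c C x.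
Proof.
rewrite /twocosh; case: (ler0P x) => x0 h.
  by rewrite -[leLHS]add0r lerD ?expR_ge0// -expR0 ler_expR mulNr -mulrN.
by rewrite -[leLHS]addr0 lerD ?expR_ge0// -expR0 ler_expR.
Qed.

(** At time a, a bridge of length a + b from x to 0 is Gaussian with mean x b/(a+b) and variance
    ab/(a+b). Taking exponential moments multiplies each rate by b/(a+b) and adds half the squared
    rate times the variance to each offset. *)
Lemma integral_heat_mul_twocosh (I : Type) (r : seq I) (c C : I -> R)
    a b s x : 0 < a -> 0 < b ->
  (\int[@lebesgue_measure R]_y
    (heat a x (y - s) * heat b (y - s) 0 *
      (1 - \sum_(i <- r) twocosh (c i) (C i) (y - s)))%:E =
  (heat (a + b) x 0 *
   (1 - \sum_(i <- r) twocosh (c i * (b / (a + b)))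
                         (C i + c i ^+ 2 * (a * b / (a + b)) / 2) x))%:E)%E.
Proof.
move=> a0 b0.
pose f y := heat a x (y - s) * heat b (y - s) 0.
pose e c' y := f y * expR (c' * (y - s)).
have eE y : f y * (1 - \sum_(i <- r) twocosh (c i) (C i) (y - s)) =
   e 0 y - \sum_(i <- r) expR (C i) * (e (c i) y + e (- c i) y).
  rewrite mulrBr mulr1 /e mul0r expR0 mulr1; congr (_ - _).
  rewrite mulr_sumr; apply: eq_bigr => i _.
  by rewrite /twocosh !expRD; ring.
have ei c' : (@lebesgue_measure R).-integrable setT (fun y => (e c' y)%:E).
  exact: heat_mul_integrable.
have ti i : (@lebesgue_measure R).-integrable setT
   (fun y => (expR (C i))%:E * ((e (c i) y)%:E + (e (- c i) y)%:E))%E.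
  by apply: integrableZl => //; exact: integrableD.
under eq_integral => y _.
  rewrite -/(f y) eE EFinB -sumEFin.
  under eq_bigr => i _ do rewrite EFinM EFinD.
  over.
rewrite integralB//; last exact: integrable_sum.
rewrite integral_sum//.
have int i : (\int[@lebesgue_measure R]_y
    ((expR (C i))%:E * ((e (c i) y)%:E + (e (- c i) y)%:E)) =
  (heat (a + b) x 0 * twocosh (c i * (b / (a + b)))
           (C i + c i ^+ 2 * (a * b / (a + b)) / 2) x)%:E)%E.
  rewrite integralZl//; last exact: integrableD.
  rewrite integralD// !integral_heat_mul_expR// -EFinD -EFinM; congr EFin.
  rewrite /twocosh -mulrDr mulrCA; congr (_ * _).
  rewrite mulrDr -!expRD; congr (expR _ + expR _);
    by field; rewrite gt_eqF ?addr_gt0.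
under eq_bigr do rewrite int.
rewrite sumEFin integral_heat_mul_expR// -EFinB; congr EFin.
by rewrite !mul0r expr0n/= !mul0r addr0 expR0 mulrBr -mulr_sumr.
Qed.

End HeatKernel.

(** * Factorisation over the curves (independence) *)

Section Product.
Context {R : realType}.
Implicit Types (F G : (nat -> R) -> \bar R).
Local Open Scope ereal_scope.

Definition vcat m (u v : nat -> R) : nat -> R :=
  fun i => if (i < m)%N then u i else v (i - m)%N.

(** No Fubini theorem is involved: [iint] integrates the first coordinates outermost, so the
    integral is only cut after m coordinates. *)
Lemma iintD m n F :
  iint (m + n) F = iint m (fun u => iint n (fun v => F (vcat m u v))).
Proof.
elim: m F => [|m IH] F /=.
  by congr (iint n _); apply/funext => v; congr F; apply/funext => i;
     rewrite /vcat subn0.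
apply: eq_integral => x _; rewrite IH.
congr (iint m _); apply/funext => u; congr (iint n _); apply/funext => v.
by congr F; apply/funext => -[|i].
Qed.

Variables (m : nat).
(** The block of curve j is passed on as the whole tail of v from index j m, so its factor has to
    ignore the later blocks. *)
Definition local_fun (f : (nat -> R) -> R) :=
  forall u v, (forall i, (i < m)%N -> u i = v i) -> f u = f v.

Lemma iint_prodS k (f : nat -> (nat -> R) -> R) : (forall j, local_fun (f j)) ->
  (forall j u, (0 <= f j u)%R) ->
  iint (k.+1 * m)
    (fun v => (\prod_(j < k.+1) f j (fun i => v (j * m + i)%N))%:E) =
  iint m (fun u => (f 0%N u)%:E *
  iint (k * m)
    (fun v => (\prod_(j < k) f j.+1 (fun i => v (j * m + i)%N))%:E)).
Proof.
move=> fl f0; rewrite mulSn iintD; congr (iint m _); apply/funext => u.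
rewrite -iintZl//; last by move=> v; rewrite lee_fin prodr_ge0.
congr (iint _ _); apply/funext => v; rewrite -EFinM; congr EFin.
rewrite big_ord_recl; congr (_ * _)%R.
  by apply: fl => i im; rewrite /vcat mul0n add0n im.
apply: eq_bigr => j _; congr (f _ _); apply/funext => i.
rewrite /vcat /= /bump leq0n add1n mulSn -addnA ltnNge leq_addr/=.
by rewrite addKn.
Qed.

(** Induction on the curves: the inner integral over the remaining curves is replaced by its
    constant bound, which is then pulled out of the outer integral. *)
Lemma iint_prod_le k (f : nat -> (nat -> R) -> R) (c : nat -> R) :
  (forall j, local_fun (f j)) -> (forall j u, (0 <= f j u)%R) ->
  (forall j, (0 <= c j)%R) ->
  (forall j, (j < k)%N -> iint m (fun u => (f j u)%:E) <= (c j)%:E) ->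
  iint (k * m)
    (fun v => (\prod_(j < k) f j (fun i => v (j * m + i)%N))%:E)
  <= (\prod_(j < k) c j)%:E.
Proof.
elim: k f c => [|k IH] f c fl f0 c0 fc; first by rewrite /= !big_ord0.
rewrite iint_prodS// big_ord_recl EFinM.
apply: (@le_trans _ _ (iint m (fun u => (\prod_(j < k) c j.+1)%:E * (f 0%N u)%:E))).
  apply: le_iint => u.
    rewrite mule_ge0 ?lee_fin//; apply: iint_ge0 => v.
    by rewrite lee_fin prodr_ge0.
  rewrite muleC lee_wpmul2r ?lee_fin//.
  by apply: (IH (fun j => f j.+1) (fun j => c j.+1)) => // j jk; exact: fc.
rewrite iintZl//; first last.
  by move=> u; rewrite lee_fin.
  by rewrite prodr_ge0.
rewrite muleC lee_wpmul2r ?lee_fin ?prodr_ge0//; exact: fc.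
Qed.

Lemma iint_prod_ge k (f : nat -> (nat -> R) -> R) (c : nat -> R) :
  (forall j, local_fun (f j)) -> (forall j u, (0 <= f j u)%R) ->
  (forall j, (0 <= c j)%R) ->
  (forall j, (j < k)%N -> (c j)%:E <= iint m (fun u => (f j u)%:E)) ->
  (\prod_(j < k) c j)%:E <=
  iint (k * m)
    (fun v => (\prod_(j < k) f j (fun i => v (j * m + i)%N))%:E).
Proof.
elim: k f c => [|k IH] f c fl f0 c0 fc; first by rewrite /= !big_ord0.
rewrite iint_prodS// big_ord_recl EFinM.
apply: (@le_trans _ _ (iint m (fun u => (\prod_(j < k) c j.+1)%:E * (f 0%N u)%:E))).
  rewrite iintZl//; first last.
    by move=> u; rewrite lee_fin.
    by rewrite prodr_ge0.
  by rewrite muleC lee_wpmul2l ?lee_fin ?prodr_ge0//; exact: fc.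
apply: le_iint => u.
  by rewrite mule_ge0 ?lee_fin// prodr_ge0.
rewrite muleC lee_wpmul2l ?lee_fin//.
by apply: (IH (fun j => f j.+1) (fun j => c j.+1)) => // j jk; exact: fc.
Qed.

End Product.

(** * One bridge on a time grid: total mass and confinement to a tube *)

Section Chain.
Context {R : realType}.
Implicit Types (t s w th u : nat -> R) (x z : R).

Definition pinned m x z u (i : nat) : R :=
  if i is i'.+1 then if (i' < m)%N then u i' else z else x.

(** The unnormalised bridge density at the grid times [t], evaluated at the path pinned at x and z
    minus a profile [s]. *)
Definition chain m t s x z u : R := \prod_(i < m.+1)
  heat (t i.+1 - t i) (pinned m x z u i - s i) (pinned m x z u i.+1 - s i.+1).

Definition shift1 (t : nat -> R) := fun i => t i.+1.

Lemma pinnedS m x z y v i : pinned m.+1 x z (vcons y v) i.+1 = pinned m y z v i.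
Proof. by case: i. Qed.

Lemma chainS m t s x z y v : chain m.+1 t s x z (vcons y v) =
  heat (t 1%N - t 0%N) (x - s 0%N) (y - s 1%N) *
  chain m (shift1 t) (shift1 s) y z v.
Proof.
rewrite /chain big_ord_recl; congr (_ * _); apply: eq_bigr => i _.
by rewrite !lift0 !pinnedS.
Qed.

Lemma chain_ge0 m t s x z u : 0 <= chain m t s x z u.
Proof. by apply: prodr_ge0 => i _; exact: heat_ge0. Qed.

Definition increasing_upto m t := forall i, (i <= m)%N -> t i < t i.+1.

Lemma increasing_upto_lt m t : increasing_upto m t -> t 0%N < t m.+1.
Proof.
elim: m t => [|m IH] t ht; first exact: ht.
apply: lt_trans (ht 0%N _) _ => //; apply: (IH (shift1 t)) => i im; exact: ht.
Qed.

(** This is the Chapman-Kolmogorov identity; the profile [s] only translates the integration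
    variables. *)
Lemma iint_chain m t s x z : increasing_upto m t ->
  (iint m (fun u => (chain m t s x z u)%:E) =
   (heat (t m.+1 - t 0%N) (x - s 0%N) (z - s m.+1))%:E)%E.
Proof.
elim: m t s x => [|m IH] t s x ht; first by rewrite /= /chain big_ord1.
have ht' : increasing_upto m (shift1 t) by move=> i im; exact: ht.
rewrite iintS.
under eq_integral => y _.
  under [X in iint _ X]funext => v do rewrite chainS EFinM.
  rewrite iintZl ?heat_ge0//; last by move=> v; rewrite lee_fin chain_ge0.
  (* A factor e^0 is inserted so that the integrand matches [integral_heat_mul_expR] with tilt 0. *)
  rewrite (IH _ _ _ ht') -EFinM -[X in X%:E]mulr1 -expR0 -(mul0r (y - s 1%N)).
  over.
rewrite integral_heat_mul_expR ?subr_gt0; last 2 first.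
- exact: ht.
- exact: increasing_upto_lt ht'.
rewrite mul0r expr0n/= !mul0r addr0 expR0 mulr1 /shift1.
by rewrite [t 1%N - t 0%N + _]addrC addrA subrK.
Qed.

Definition in_tube m s w u : R :=
  \prod_(i < m) Defs.indic R (`|u i - s i.+1| <= w i.+1).

Lemma in_tube_ge0 m s w u : 0 <= in_tube m s w u.
Proof. by apply: prodr_ge0 => i _; rewrite /Defs.indic; case: ifP. Qed.

(** The fraction of time left at the point i + 1. Its product with the elapsed time is the variance
    of the bridge there. *)
Definition remaining m t i := (t m.+1 - t i.+1) / (t m.+1 - t 0%N).

(* A union bound carried through the iterated integral: 1 - twocosh is <= 0
   outside the tube, and the heat kernels map twocosh to twocosh. *)
Lemma iint_chain_tube m t s w th x z : increasing_upto m t -> z = s m.+1 ->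
  (forall i, 0 <= th i) ->
  ((heat (t m.+1 - t 0%N) (x - s 0%N) 0 *
    (1 - \sum_(i < m) twocosh (th i.+1 * remaining m t i)
        (- (th i.+1 * w i.+1) +
          th i.+1 ^+ 2 * (remaining m t i * (t i.+1 - t 0%N)) / 2)
        (x - s 0%N)))%:E <=
  iint m (fun u => (in_tube m s w u * chain m t s x z u)%:E))%E.
Proof.
move=> + zE th0; elim: m t s w th x zE th0 => [|m IH] t s w th x zE th0 ht.
  by rewrite /= /chain big_ord1 /in_tube !big_ord0 subr0 mulr1 mul1r /= zE subrr.
have ht' : increasing_upto m (shift1 t) by move=> i im; exact: ht.
have a0 : 0 < t 1%N - t 0%N by rewrite subr_gt0; exact: ht.
have b0 : 0 < t m.+2 - t 1%N by rewrite subr_gt0; exact: increasing_upto_lt ht'.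
(* Offsets and rates as seen from the first interior point: entry 0 belongs to that point itself,
   the later ones come from the induction hypothesis on the shifted grid. *)
pose C i := - (th i.+1 * w i.+1) + (if i is i'.+1 then
   th i.+1 ^+ 2 * (remaining m (shift1 t) i' * (t i.+1 - t 1%N)) / 2 else 0).
pose c i := th i.+1 * (if i is i'.+1 then remaining m (shift1 t) i' else 1).
have -> : heat (t m.+2 - t 0%N) (x - s 0%N) 0 *
    (1 - \sum_(i < m.+1) twocosh (th i.+1 * remaining m.+1 t i)
        (- (th i.+1 * w i.+1) +
          th i.+1 ^+ 2 * (remaining m.+1 t i * (t i.+1 - t 0%N)) / 2)
        (x - s 0%N)) =
  heat ((t 1%N - t 0%N) + (t m.+2 - t 1%N)) (x - s 0%N) 0 *
   (1 - \sum_(i < m.+1) twocosh (c i *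
       ((t m.+2 - t 1%N) / ((t 1%N - t 0%N) + (t m.+2 - t 1%N))))
      (C i + c i ^+ 2 * ((t 1%N - t 0%N) * (t m.+2 - t 1%N) /
           ((t 1%N - t 0%N) + (t m.+2 - t 1%N))) / 2) (x - s 0%N)).
  have -> : (t 1%N - t 0%N) + (t m.+2 - t 1%N) = t m.+2 - t 0%N by ring.
  congr (_ * (1 - _)); apply: eq_bigr => -[[|i] im] _ /=.
    rewrite /c /C /= /remaining addr0 mulr1.
    by rewrite [_ / _ * (t 1%N - t 0%N)]mulrAC [(t 1%N - t 0%N) * _]mulrC.
  have n1 : t m.+2 - t 1%N != 0 by rewrite gt_eqF.
  have n2 : t m.+2 - t 0%N != 0.
    by rewrite gt_eqF// subr_gt0; exact: increasing_upto_lt ht.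
  rewrite /c /C /= /remaining /shift1.
  set x1 := t m.+2; set y1 := t 0%N; set z1 := t 1%N; set u1 := t i.+2.
  have -> : th i.+2 * ((x1 - u1) / (x1 - z1)) * ((x1 - z1) / (x1 - y1)) =
    th i.+2 * ((x1 - u1) / (x1 - y1)) by field; rewrite n1 n2.
  have -> : - (th i.+2 * w i.+2) +
     th i.+2 ^+ 2 * ((x1 - u1) / (x1 - z1) * (u1 - z1)) / 2 +
     (th i.+2 * ((x1 - u1) / (x1 - z1))) ^+ 2 *
        ((z1 - y1) * (x1 - z1) / (x1 - y1)) / 2 =
     - (th i.+2 * w i.+2) +
     th i.+2 ^+ 2 * ((x1 - u1) / (x1 - y1) * (u1 - y1)) / 2.
    by field; rewrite n1 n2.
  by [].
rewrite -(integral_heat_mul_twocosh _ _ _ _ _ _ (s 1%N))// iintS.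
have in_tubeS y v : in_tube m.+1 s w (vcons y v) =
   Defs.indic R (`|y - s 1%N| <= w 1%N) * in_tube m (shift1 s) (shift1 w) v.
  by rewrite /in_tube big_ord_recl.
apply: le_integralT_ge0 => y.
  by apply: iint_ge0 => v; rewrite lee_fin mulr_ge0 ?in_tube_ge0 ?chain_ge0.
under [X in (_ <= iint _ X)%E]funext => v.
  rewrite in_tubeS chainS mulrACA EFinM; over.
rewrite iintZl; first last.
- by move=> v; rewrite lee_fin mulr_ge0 ?in_tube_ge0 ?chain_ge0.
- by rewrite mulr_ge0 ?heat_ge0// /Defs.indic; case: ifP.
case: (leP `|y - s 1%N| (w 1%N)) => yw; rewrite /Defs.indic; last first.
  rewrite mul0r mul0e lee_fin -mulrA mulr_ge0_le0 ?heat_ge0//.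
  rewrite mulr_ge0_le0 ?heat_ge0// big_ord_recl opprD addrA.
  have t1 : 1 <= twocosh (c 0%N) (C 0%N) (y - s 1%N).
    apply: twocosh_ge1; rewrite /c /C mulr1 addr0 -mulrBr mulr_ge0//.
    by rewrite subr_ge0 ltW.
  have t2 : 0 <= \sum_(i < m) twocosh (c (lift ord0 i)) (C (lift ord0 i)) (y - s 1%N).
    by apply: sumr_ge0 => i _; rewrite addr_ge0 ?expR_ge0.
  by rewrite subr_le0 (le_trans _ t2)// subr_le0.
(* Inside the tube the nonnegative term of the first point is dropped, which leaves the induction
   hypothesis. *)
apply: le_trans; last first.
  apply: lee_wpmul2l; last exact: (IH (shift1 t) (shift1 s) (shift1 w) (shift1 th) y zE
     (fun i => th0 i.+1) ht').
  by rewrite lee_fin mul1r heat_ge0.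
rewrite mul1r -EFinM lee_fin -mulrA ler_wpM2l ?heat_ge0// /shift1.
rewrite ler_wpM2l ?heat_ge0// lerB// big_ord_recl.
rewrite -[leLHS]add0r lerD ?addr_ge0 ?expR_ge0//.
Qed.

End Chain.

(** * Concave functions on a grid and the least concave majorant *)

Section Grid.
Context {R : realType}.
Implicit Types (t y z G : nat -> R) (m i : nat).

Definition slope t y i := (y i.+1 - y i) / (t i.+1 - t i).

Definition interp t y i :=
  ((t i.+2 - t i.+1) * y i + (t i.+1 - t i) * y i.+2) / (t i.+2 - t i).

Definition concave_upto m t y := forall i, (i < m)%N -> interp t y i <= y i.+1.

Lemma interpD t y z (c : R) i :
  interp t (fun i => y i + c * z i) i = interp t y i + c * interp t z i.
Proof. by rewrite /interp; ring. Qed.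

Lemma sum_by_parts m y z :
  \sum_(i < m.+1) y i * (z i.+1 - z i) =
  y m * z m.+1 - y 0%N * z 0%N + \sum_(i < m) (y i - y i.+1) * z i.+1.
Proof.
elim: m => [|m IH]; first by rewrite big_ord1 big_ord0 addr0 mulrBr.
by rewrite big_ord_recr IH [in RHS]big_ord_recr /=; ring.
Qed.

Lemma sum_drop m y : \sum_(i < m) (y i - y i.+1) = y 0%N - y m.
Proof.
elim: m => [|m IH]; first by rewrite big_ord0 subrr.
by rewrite big_ord_recr IH /= addrA subrK.
Qed.

Variables (m : nat) (t : nat -> R).
Hypothesis tincr : increasing_upto m t.

Let dt_gt0 i : (i <= m)%N -> 0 < t i.+1 - t i.
Proof. by move=> im; rewrite subr_gt0 tincr. Qed.

Let dt2_gt0 i : (i < m)%N -> 0 < t i.+2 - t i.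
Proof.
by move=> im; rewrite subr_gt0 (@lt_trans _ _ (t i.+1))// tincr// ltnW.
Qed.

Lemma slope_drop y i : (i < m)%N ->
  slope t y i - slope t y i.+1 =
  (y i.+1 - interp t y i) *
    ((t i.+2 - t i) / ((t i.+1 - t i) * (t i.+2 - t i.+1))).
Proof.
move=> im; rewrite /slope /interp; field.
by rewrite !gt_eqF ?dt_gt0 ?dt2_gt0// ltnW.
Qed.

Let drop_fact_gt0 i : (i < m)%N ->
  0 < (t i.+2 - t i) / ((t i.+1 - t i) * (t i.+2 - t i.+1)).
Proof. by move=> im; rewrite divr_gt0 ?mulr_gt0 ?dt_gt0 ?dt2_gt0// ltnW. Qed.

Lemma slope_drop_ge0 y i : (i < m)%N -> concave_upto m t y ->
  0 <= slope t y i - slope t y i.+1.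
Proof.
by move=> im /(_ _ im) h; rewrite slope_drop// mulr_ge0 ?subr_ge0// ltW// drop_fact_gt0.
Qed.

Lemma slope_drop_gt0 y i : (i < m)%N ->
  (0 < slope t y i - slope t y i.+1) = (interp t y i < y i.+1).
Proof.
by move=> im; rewrite slope_drop// pmulr_lgt0 ?drop_fact_gt0// subr_gt0.
Qed.

Lemma le_interp y z i : (i < m)%N -> y i <= z i -> y i.+2 <= z i.+2 ->
  interp t y i <= interp t z i.
Proof.
move=> im h1 h2; rewrite ler_pM2r ?invr_gt0 ?dt2_gt0//.
by rewrite lerD// ler_pM2l// dt_gt0// ltnW.
Qed.

Lemma interp_affine (p q : R) i : (i < m)%N ->
  interp t (fun i => p * t i + q) i = p * t i.+1 + q.
Proof. by move=> im; rewrite /interp; field; rewrite gt_eqF ?dt2_gt0. Qed.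

Lemma concaveD y z (c : R) : 0 <= c -> concave_upto m t y ->
  concave_upto m t z -> concave_upto m t (fun i => y i + c * z i).
Proof.
by move=> c0 hy hz i im; rewrite interpD lerD ?hy// ler_wpM2l ?hz.
Qed.

(** A trapezoid: plateau r, sides of slope p and -p with value q at the two ends. It serves below
    both as the tent (q = 0) and as the ramp (q = -1, r = 0). *)
Definition cap (p q r : R) i : R :=
  Num.min r (Num.min (p * (t i - t 0%N) + q) (p * (t m.+1 - t i) + q)).

(** Each of the three affine pieces dominates [cap] at the neighbouring points and equals its own
    chord at the middle point. *)
Lemma cap_concave p q r : concave_upto m t (cap p q r).
Proof.
move=> i im; rewrite {2}/cap !le_min; apply/and3P; split.
- rewrite -[leRHS]add0r -[0](mul0r (t i.+1)) -interp_affine//.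
  by apply: le_interp => //; rewrite mul0r add0r /cap ge_min lexx.
- have -> : p * (t i.+1 - t 0%N) + q = p * t i.+1 + (q - p * t 0%N) by ring.
  rewrite -interp_affine//.
  apply: le_interp => //; rewrite /cap !ge_min; apply/orP; right; apply/orP;
    left; rewrite mulrBr; lra.
- have -> : p * (t m.+1 - t i.+1) + q = - p * t i.+1 + (q + p * t m.+1) by ring.
  rewrite -interp_affine//.
  apply: le_interp => //; rewrite /cap !ge_min; apply/orP; right; apply/orP;
    right; rewrite mulrBr mulNr; lra.
Qed.

Definition majorant G y :=
  concave_upto m t y /\ forall i, (i <= m.+1)%N -> G i <= y i.

Definition majorant_values G i : set R := [set x | exists2 y, majorant G y & x = y i].

(** The infimum is meaningful for i <= m + 1 only, since a majorant is unconstrained beyond the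
    grid. *)
Definition least_concave G i := inf (majorant_values G i).

Section LeastConcave.
Variable G : nat -> R.

Let has_lb i : (i <= m.+1)%N -> lbound (majorant_values G i) (G i).
Proof. by move=> im _ [y [_ hy] ->]; exact: hy. Qed.

Let set_neq0 i : (majorant_values G i  !=set0)%classic.
Proof.
pose M := \big[Num.max/0]_(j < m.+2) G j.
exists M; exists (fun=> M) => //; split=> [j jm|j jm].
  have := interp_affine 0 M j jm; rewrite /interp !mul0r !add0r => ->.
  exact: lexx.
exact: (le_bigmax 0 (fun k : 'I_m.+2 => G k) (Ordinal (jm : (j < m.+2)%N))).
Qed.

Lemma le_least_concave i : (i <= m.+1)%N -> G i <= least_concave G i.
Proof. by move=> im; apply: lb_le_inf; [exact: set_neq0|exact: has_lb]. Qed.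

Lemma least_concave_le y i : (i <= m.+1)%N -> majorant G y ->
  least_concave G i <= y i.
Proof.
move=> im hy; apply: ge_inf; last by exists y.
by exists (G i); exact: has_lb.
Qed.

Lemma least_concave_concave : concave_upto m t (least_concave G).
Proof.
move=> i im; apply: lb_le_inf; first exact: set_neq0.
move=> _ [y hy ->]; apply: le_trans (hy.1 _ im); apply: le_interp => //;
  by apply: least_concave_le => //; lia.
Qed.

(** Lowering one value of a concave function can only lower the chords over the neighbouring points.
    So concavity need be rechecked only at j itself, and minimality forbids any real lowering. *)
Let lower j v : (j <= m.+1)%N -> G j <= v -> v <= least_concave G j ->
  (forall i, j = i.+1 -> (i < m)%N -> interp t (least_concave G) i <= v) ->
  least_concave G j <= v.
Proof.
move=> jm Gv vl hv.
pose y i := if i == j then v else least_concave G i.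
have yl i : y i <= least_concave G i by rewrite /y; case: eqP => [->|].
suff hy : majorant G y.
  by have := least_concave_le _ _ jm hy; rewrite /y eqxx.
split=> i im; last by rewrite /y; case: eqP => [->//|_]; exact: le_least_concave.
rewrite [leRHS]/y; case: eqP => [e|_].
  by apply: le_trans (hv i (esym e) im); exact: le_interp.
by apply: le_trans (least_concave_concave _ im); exact: le_interp.
Qed.

(** At a kink strictly above G, the value could be lowered to the maximum of G and the chord. *)
Lemma least_concave_kink i : (i < m)%N ->
  0 < slope t (least_concave G) i - slope t (least_concave G) i.+1 ->
  least_concave G i.+1 = G i.+1.
Proof.
move=> im; rewrite slope_drop_gt0// => h.
apply/eqP; rewrite eq_le le_least_concave ?andbT; last by lia.
rewrite leNgt; apply/negP => h2.
have : least_concave G i.+1 <= Num.max (G i.+1) (interp t (least_concave G) i).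
  apply: lower; rewrite ?le_max ?lexx//; first by lia.
    by rewrite ge_max !ltW.
  by move=> j [<-] _; rewrite le_max lexx orbT.
by rewrite le_max !leNgt h h2.
Qed.

Lemma least_concave0 : least_concave G 0%N = G 0%N.
Proof.
apply/eqP; rewrite eq_le le_least_concave// andbT.
by apply: lower => //; exact: le_least_concave.
Qed.

Lemma least_concave_last : least_concave G m.+1 = G m.+1.
Proof.
apply/eqP; rewrite eq_le le_least_concave// andbT.
apply: lower => //; first exact: le_least_concave.
by move=> i [<-]; rewrite ltnn.
Qed.

Lemma slope_step y i : (i <= m)%N -> y i.+1 = y i + slope t y i * (t i.+1 - t i).
Proof. by move=> im; rewrite /slope divfK ?gt_eqF ?dt_gt0// addrC subrK. Qed.

Variable B : R.
Hypothesis B0 : 0 <= B.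
Hypothesis G0 : 0 <= G 0%N.
Hypothesis Gm : 0 <= G m.+1.
Hypothesis GB : forall i, (i < m)%N -> G i.+1 <= B * (t i.+1 - t 0%N).
Hypothesis GB' : forall i, (i < m)%N -> G i.+1 <= B * (t m.+1 - t i.+1).
Let psi := least_concave G.

Let t_incr i j : (i < j)%N -> (j <= m.+1)%N -> t i < t j.
Proof.
move=> ij jm; elim: j ij jm => // j IH; rewrite ltnS leq_eqVlt => /predU1P[->|ij] jm.
  exact: tincr.
by apply: lt_trans (IH ij _) (tincr _ _); lia.
Qed.

(** Up to the first kink psi is a line starting at a nonnegative height. At the kink it equals G,
    hence lies below the line of slope B from 0, so its slope is at most B. *)
Let first_slope i : (i <= m)%N -> slope t psi 0 <= B \/
  slope t psi i = slope t psi 0 /\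
  psi i.+1 = psi 0%N + slope t psi 0 * (t i.+1 - t 0%N).
Proof.
elim: i => [_|i IH im]; first by right; split=> //; exact: slope_step.
have [?|[e1 e2]] := IH (ltnW im); first by left.
have := slope_drop_ge0 psi i im least_concave_concave.
rewrite le_eqVlt => /predU1P[/esym/eqP|k]; last first.
  left; have := least_concave_kink _ im k; rewrite -/psi e2 => e3.
  have := GB i im; rewrite -e3 {1}/psi least_concave0 => h.
  have tt : 0 < t i.+1 - t 0%N by rewrite subr_gt0 t_incr//; lia.
  by rewrite -(ler_pM2r tt); apply: le_trans h; rewrite lerDr.
rewrite subr_eq0 => /eqP e3; right; rewrite -e3; split=> //.
by rewrite slope_step// -e3 e1 e2; ring.
Qed.

Let last_slope i : (i <= m)%N -> - B <= slope t psi m \/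
  slope t psi (m - i)%N = slope t psi m /\
  psi (m - i)%N = psi m.+1 - slope t psi m * (t m.+1 - t (m - i)%N).
Proof.
elim: i => [_|i IH im].
  by right; rewrite subn0; split=> //; rewrite (slope_step psi m)//; ring.
have [?|] := IH (ltnW im); first by left.
have -> : (m - i = (m - i.+1).+1)%N by lia.
have : ((m - i.+1) < m)%N by lia.
move: (m - i.+1)%N => j jm [e1 e2].
have := slope_drop_ge0 psi j jm least_concave_concave.
rewrite le_eqVlt => /predU1P[/esym/eqP|k]; last first.
  left; have := least_concave_kink _ jm k; rewrite -/psi e2 => e3.
  have := GB' j jm; rewrite -e3 {1}/psi least_concave_last => h.
  have tt : 0 < t m.+1 - t j.+1 by rewrite subr_gt0 t_incr//; lia.
  rewrite lerNl -(ler_pM2r tt); apply: le_trans h.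
  by rewrite mulNr lerDr.
rewrite subr_eq0 => /eqP e3; right; rewrite e3; split=> //.
have := slope_step psi j (ltnW jm); rewrite e3 e1 e2 => /eqP.
by rewrite -subr_eq => /eqP <-; ring.
Qed.

(** Either psi is affine, or the initial slope is at most B and the final one at least -B. *)
Lemma least_concave_total_drop : slope t psi 0 - slope t psi m <= B *+ 2.
Proof.
have BB : 0 <= B *+ 2 by rewrite mulrn_wge0.
have [h|[-> _]] := first_slope m (leqnn m); last by rewrite subrr.
have [h'|[]] := last_slope m (leqnn m); last by rewrite subnn => -> _; rewrite subrr.
by rewrite mulr2n lerD// lerNl.
Qed.

End LeastConcave.
End Grid.

(** * Energy of a path and the two density comparisons for one curve *)

Section Energy.
Context {R : realType}.
Implicit Types (t y z s u w h G : nat -> R) (m i : nat).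

Definition energy m t y : R :=
  \sum_(i < m.+1) (y i.+1 - y i) ^+ 2 / (2 * (t i.+1 - t i)).

Definition norm_const m t : R :=
  \prod_(i < m.+1) (Num.sqrt (2 * pi * (t i.+1 - t i)))^-1.

Lemma chainE m t s (x z : R) u : chain m t s x z u =
  norm_const m t * expR (- energy m t (fun i => pinned m x z u i - s i)).
Proof.
rewrite /chain /norm_const /energy -sumrN expR_sum -big_split /=.
by apply: eq_bigr => i _; rewrite /heat mulrC; congr (_ * expR _); exact: mulNr.
Qed.

Lemma norm_const_ge0 m t : 0 <= norm_const m t.
Proof. by apply: prodr_ge0 => i _; rewrite invr_ge0 sqrtr_ge0. Qed.

Lemma energy_half m t y : energy m (fun i => t i / 2) y = 2 * energy m t y.
Proof.
rewrite /energy mulr_sumr; apply: eq_bigr => i _.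
rewrite -mulrBl !invfM invrK; set e := (t i.+1 - t i)^-1; set a := _ ^+ 2; by field.
Qed.

Lemma sqrt_double (d : R) :
  Num.sqrt (2 * pi * d) = Num.sqrt 2 * Num.sqrt (2 * pi * (d / 2)).
Proof.
by rewrite -sqrtrM ?ler0n//; congr Num.sqrt; field.
Qed.

Lemma norm_const_half m t : norm_const m t =
  norm_const m (fun i => t i / 2) / Num.sqrt 2 ^+ m.+1.
Proof.
rewrite /norm_const -exprVn -[X in _ ^+ X](card_ord m.+1) -prodr_const.
rewrite -big_split; apply: eq_bigr => i _ /=.
by rewrite -mulrBl sqrt_double invfM [LHS]mulrC.
Qed.

Variables (m : nat) (t : nat -> R).
Hypothesis tincr : increasing_upto m t.

Let dt_gt0 i : (i <= m)%N -> 0 < t i.+1 - t i.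
Proof. by move=> im; rewrite subr_gt0 tincr. Qed.

Lemma energyD y z : energy m t (fun i => y i + z i) =
  energy m t y + \sum_(i < m.+1) slope t y i * (z i.+1 - z i) + energy m t z.
Proof.
rewrite /energy -!big_split; apply: eq_bigr => -[i im] _ /=.
by rewrite /slope; field; rewrite gt_eqF ?dt_gt0.
Qed.

Lemma energyD_le y z :
  energy m t (fun i => y i + z i) <= 2 * energy m t y + 2 * energy m t z.
Proof.
rewrite /energy !mulr_sumr -big_split; apply: ler_sum => -[i im] _ /=.
rewrite !mulrA -mulrDl ler_pM2r ?invr_gt0 ?mulr_gt0 ?dt_gt0//.
have : 0 <= (y i.+1 - y i - (z i.+1 - z i)) ^+ 2 by exact: sqr_ge0.
by nra.
Qed.

Lemma sum_slope_drop y z : z 0%N = 0 -> z m.+1 = 0 ->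
  \sum_(i < m.+1) slope t y i * (z i.+1 - z i) =
  \sum_(i < m) (slope t y i - slope t y i.+1) * z i.+1.
Proof. by move=> z0 zm; rewrite sum_by_parts z0 zm !mulr0 subrr add0r. Qed.

(** Summation by parts turns twice the energy into a sum of h against its slope drops, which are
    nonnegative by concavity. *)
Lemma concave_energy_le h (H : R) : concave_upto m t h ->
  h 0%N = 0 -> h m.+1 = 0 -> (forall i, (i < m)%N -> h i.+1 <= H) ->
  2 * energy m t h <= H * (slope t h 0 - slope t h m).
Proof.
move=> hc h0 hm hH.
have -> : 2 * energy m t h = \sum_(i < m.+1) slope t h i * (h i.+1 - h i).
  rewrite /energy mulr_sumr; apply: eq_bigr => -[i im] _ /=.
  by rewrite /slope; field; rewrite gt_eqF ?dt_gt0.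
rewrite sum_slope_drop// -sum_drop mulr_sumr; apply: ler_sum => -[i im] _ /=.
by rewrite [leRHS]mulrC ler_wpM2l ?hH// (slope_drop_ge0 _ _ tincr).
Qed.

Section Majorant.
Variables (G : nat -> R) (x z : R).
Hypothesis Gx : G 0%N = x.
Hypothesis Gz : G m.+1 = z.
Let psi := least_concave m t G.
Let kappa i := slope t psi i - slope t psi i.+1.

Let kappa_ge0 i : (i < m)%N -> 0 <= kappa i.
Proof. by move=> im; apply: (slope_drop_ge0 _ _ tincr) => //; exact: least_concave_concave. Qed.

Let pinned_last u : pinned m x z u m.+1 = z.
Proof. by rewrite /= ltnn. Qed.

Let pinned_mid u i : (i < m)%N -> pinned m x z u i.+1 = u i.
Proof. by move=> im; rewrite /= im. Qed.

(* The slope of psi only drops where psi = G, so a path above G only loses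
   energy when psi is subtracted. *)
Lemma chain_le_majorant u : (forall i, (i < m)%N -> G i.+1 <= u i) ->
  chain m t (fun=> 0) x z u <= expR (- energy m t psi) * chain m t psi x z u.
Proof.
move=> Gu; rewrite !chainE mulrCA ler_wpM2l ?norm_const_ge0// -expRD ler_expR.
rewrite -opprD lerN2.
pose Z i := pinned m x z u i - psi i.
have -> : energy m t (fun i => pinned m x z u i - 0) =
    energy m t (fun i => psi i + Z i).
  by apply: eq_bigr => i _; rewrite /Z !subr0 ![psi _ + _]addrC !subrK.
rewrite -/Z (energyD psi Z) lerD2r lerDl sum_slope_drop; last 2 first.
- by rewrite /Z /= /psi least_concave0// Gx subrr.
- by rewrite /Z pinned_last /psi least_concave_last// Gz subrr.
apply: sumr_ge0 => -[i im] _; rewrite -/(kappa i).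
have := kappa_ge0 _ im; rewrite le_eqVlt => /predU1P[<-|k]; first by rewrite mul0r.
rewrite mulr_ge0 ?(ltW k)// /Z pinned_mid// subr_ge0 /psi.
by rewrite least_concave_kink// Gu.
Qed.

Variables (B M H P : R) (h w : nat -> R).
Hypothesis drop : slope t psi 0 - slope t psi m <= B.
Hypothesis h_concave : concave_upto m t h.
Hypothesis h0 : h 0%N = 0.
Hypothesis hm : h m.+1 = 0.
Hypothesis hH : forall i, (i < m)%N -> h i.+1 <= H.
Hypothesis hP : slope t h 0 - slope t h m <= P.
Hypothesis hwM : forall i, (i < m)%N -> h i.+1 + w i.+1 <= M.
Hypothesis M0 : 0 <= M.
Hypothesis H0 : 0 <= H.
Let s i := psi i + h i.

(* Since (x + y)^2 <= 2 x^2 + 2 y^2, the shift by h can be split off at the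
   price of running the bridge at half speed. *)
Lemma chain_ge_tube u : (forall i, (i < m)%N -> `|u i - s i.+1| <= w i.+1) ->
  expR (- energy m t psi) * (expR (- (B * M + H * P)) *
    (chain m (fun i => t i / 2) s x z u / Num.sqrt 2 ^+ m.+1)) <=
  chain m t (fun=> 0) x z u.
Proof.
move=> us; rewrite !chainE energy_half.
pose Z i := pinned m x z u i - s i.
pose HZ i := h i + Z i.
rewrite -/Z [X in _ * (_ * X)]mulrAC -norm_const_half mulrCA.
rewrite [X in _ * X]mulrCA mulrCA ler_wpM2l ?norm_const_ge0// -!expRD ler_expR.
have -> : energy m t (fun i => pinned m x z u i - 0) =
    energy m t (fun i => psi i + HZ i).
  apply: eq_bigr => i _; rewrite !subr0; congr (_ ^+ 2 / _).
  by rewrite /HZ /Z /s; ring.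
rewrite (energyD psi HZ) sum_slope_drop; last 2 first.
- by rewrite /HZ /Z /s /= /psi least_concave0// Gx h0; ring.
- by rewrite /HZ /Z /s pinned_last /psi least_concave_last// Gz hm; ring.
(* On the tube [HZ] is at most h + w, hence at most M, and the nonnegative slope drops of psi add up
   to at most B. *)
have e1 : \sum_(i < m) (slope t psi i - slope t psi i.+1) * HZ i.+1
    <= B * M.
  apply: (@le_trans _ _ (\sum_(i < m) (slope t psi i - slope t psi i.+1) * M)).
    apply: ler_sum => -[i im] _; rewrite ler_wpM2l//; first exact: kappa_ge0.
    apply: le_trans (hwM _ im); rewrite /HZ lerD2l /Z pinned_mid//.
    by apply: le_trans (us _ im); exact: ler_norm.
  by rewrite -mulr_suml ler_wpM2r// sum_drop.
have e2 := energyD_le h Z.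
have e3 := concave_energy_le _ _ h_concave h0 hm hH.
have e4 : H * (slope t h 0 - slope t h m) <= H * P by rewrite ler_wpM2l.
rewrite -/HZ in e2.
by lra.
Qed.

Hypothesis w_gt0 : forall i, (i < m)%N -> 0 < w i.+1.
Hypothesis w_large : forall i, (i < m)%N ->
  m%:R * (4 * (remaining m t i * (t i.+1 - t 0%N))) <= w i.+1 ^+ 2.

Let t_half : increasing_upto m (fun i => t i / 2).
Proof. by move=> i im; rewrite ltr_pM2r ?invr_gt0// tincr. Qed.

Let t_incr i : (i < m)%N -> t 0%N < t i.+1 /\ t i.+1 < t m.+1.
Proof.
move=> im; split.
  by apply: (increasing_upto_lt i) => j ji; apply: tincr; lia.
have -> : m.+1 = ((m - i.+1).+1 + i.+1)%N by lia.
apply: (increasing_upto_lt (m - i.+1) (fun j => t (j + i.+1)%N)) => j ji.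
by rewrite addSn; apply: tincr; lia.
Qed.

Let tot_gt0 : 0 < t m.+1 - t 0%N.
Proof. by rewrite subr_gt0 increasing_upto_lt. Qed.

(** The half-speed bridge stays in the tube with probability at least 1/2. With v its variance, each
    of the m points costs 2 exp(-w^2/(2v)), and w^2/(2v) >= 4m makes this at most 1/(2m). *)
Lemma iint_tube_half :
  ((heat ((t m.+1 - t 0%N) / 2) 0 0 / 2)%:E <=
   iint m (fun u => (in_tube m s w u *
      chain m (fun i => t i / 2) s x z u)%:E))%E.
Proof.
pose v i := remaining m t i * (t i.+1 - t 0%N) / 2.
(* The rate w/v minimises the Chernoff exponent - th w + th^2 v/2; [v] is indexed one lower than
   [w]. *)
pose th i := if (0 < i <= m)%N then w i / v i.-1 else 0.
have v0 i : (i < m)%N -> 0 < v i.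
  move=> /t_incr[h1 h2].
  by rewrite /v /remaining !mulr_gt0 ?invr_gt0 ?tot_gt0// subr_gt0.
have vE i : remaining m (fun j => t j / 2) i * (t i.+1 / 2 - t 0%N / 2) = v i.
  have n0 : t m.+1 - t 0%N != 0 by rewrite gt_eqF.
  by rewrite /v /remaining; field; rewrite ?n0 -?mulrBl ?mulf_neq0.
have th0 i : 0 <= th i.
  rewrite /th; case: i => [|i]//=; case: ltnP => // im.
  by rewrite divr_ge0// ltW ?w_gt0 ?v0.
have s0 : x - s 0%N = 0 by rewrite /s /psi least_concave0// Gx h0 addr0 subrr.
have sm : z = s m.+1 by rewrite /s /psi least_concave_last// Gz hm addr0.
apply: le_trans (iint_chain_tube _ _ _ _ th _ _ t_half sm th0).
rewrite lee_fin s0 -mulrBl ler_wpM2l ?heat_ge0// lerBrDr -lerBrDl.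
have -> : 1 - 2^-1 = 2^-1 :> R by field.
apply: (@le_trans _ _ (\sum_(i < m) (m%:R^-1 / 2))); last first.
  rewrite sumr_const card_ord -(mulr_natl (m%:R^-1 / 2)) mulrA.
  by case: (m) => [|n]; rewrite ?mul0r// mulfV ?pnatr_eq0// mul1r.
apply: ler_sum => -[i im] _ /=.
have mp : 0 < m%:R :> R by rewrite ltr0n; lia.
rewrite vE /twocosh !mulr0 !add0r /th im /=.
have vi := v0 _ im.
have := w_large _ im.
have -> : remaining m t i * (t i.+1 - t 0%N) = 2 * v i by rewrite /v; field.
move=> wl.
have -> : - (w i.+1 / v i * w i.+1) + (w i.+1 / v i) ^+ 2 * v i / 2 =
   - (w i.+1 ^+ 2 / (2 * v i)) by field; rewrite gt_eqF.
have l1 : 4 * m%:R <= w i.+1 ^+ 2 / (2 * v i).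
  have vv : 0 < 2 * v i by rewrite mulr_gt0.
  by rewrite ler_pdivlMr//; apply: le_trans wl; rewrite mulrA [_ * 4]mulrC.
have l2 : expR (- (w i.+1 ^+ 2 / (2 * v i))) <= (4 * m%:R)^-1.
  rewrite expRN lef_pV2 ?posrE ?expR_gt0 ?mulr_gt0//.
  apply: le_trans (expR_ge1Dx _).
  by apply: le_trans l1 _; rewrite lerDr.
apply: le_trans (lerD l2 l2) _.
by rewrite le_eqVlt; apply/orP; left; apply/eqP; field; rewrite gt_eqF.
Qed.

Lemma iint_curve_ge :
  ((expR (- energy m t psi) * heat (t m.+1 - t 0%N) 0 0 *
    (expR (- (B * M + H * P)) / Num.sqrt 2 ^+ m / 2))%:E <=
  iint m (fun u => (in_tube m s w u * chain m t (fun=> 0) x z u)%:E))%E.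
Proof.
pose c := expR (- energy m t psi) * (expR (- (B * M + H * P)) / Num.sqrt 2 ^+ m.+1).
have c0 : 0 <= c by rewrite !mulr_ge0 ?expR_ge0// invr_ge0 exprn_ge0 ?sqrtr_ge0.
apply: (@le_trans _ _ (iint m (fun u => c%:E *
   (in_tube m s w u * chain m (fun i => t i / 2) s x z u)%:E)%E)); last first.
  apply: le_iint => u.
    by rewrite -EFinM lee_fin !mulr_ge0 ?in_tube_ge0 ?chain_ge0.
  rewrite -EFinM lee_fin.
  have [us|] := pselect (forall i, (i < m)%N -> `|u i - s i.+1| <= w i.+1).
    rewrite mulrCA ler_wpM2l ?in_tube_ge0//.
    apply: le_trans (chain_ge_tube _ us); rewrite /c -!mulrA.
    by rewrite [_^-1 * chain _ _ _ _ _ _]mulrC.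
  move=> /existsNP[i /not_implyP[im /negP ui]].
  have -> : in_tube m s w u = 0.
    rewrite /in_tube (bigD1 (Ordinal im))//= /Defs.indic (negbTE ui).
    by rewrite mul0r.
  by rewrite !mul0r mulr0.
rewrite iintZl//; last by move=> u; rewrite lee_fin mulr_ge0 ?in_tube_ge0 ?chain_ge0.
apply: le_trans; last first.
  by apply: lee_wpmul2l; [rewrite lee_fin|exact: iint_tube_half].
rewrite -EFinM lee_fin /c exprS.
(* Halving the total time gives back one of the m + 1 factors sqrt 2 lost in the increments. *)
have -> : heat ((t m.+1 - t 0%N) / 2) 0 0 =
    Num.sqrt 2 * heat (t m.+1 - t 0%N) 0 0 :> R.
  rewrite /heat subrr expr0n/= oppr0 !mul0r expR0 !mul1r.
  by rewrite [in RHS]sqrt_double invfM [RHS]mulrA mulfV ?mul1r// gt_eqF ?sqrtr_gt0.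
rewrite le_eqVlt; apply/orP; left; apply/eqP.
have q2 : Num.sqrt 2 != 0 :> R by rewrite gt_eqF ?sqrtr_gt0.
by field; rewrite q2 expf_neq0.
Qed.
End Majorant.
End Energy.

(** * Comparison of majorants, tents and the barrier g *)

Section Geometry.
Context {R : realType}.
Variables (m : nat) (t : nat -> R).
Hypothesis tincr : increasing_upto m t.

Let t_le i j : (i <= j)%N -> (j <= m.+1)%N -> t i <= t j.
Proof.
move=> ij jm; elim: j ij jm => [|j IH]; first by case: i.
rewrite leq_eqVlt => /predU1P[->//|ij] jm.
by apply: le_trans (IH ij (ltnW jm)) _; rewrite ltW// tincr.
Qed.

Let t_lt i : (i <= m)%N -> t i < t i.+1.
Proof. exact: tincr. Qed.

Lemma concaveZ (a : R) y : 0 <= a -> concave_upto m t y ->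
  concave_upto m t (fun i => a * y i).
Proof.
move=> a0 hy i im; apply: le_trans (ler_wpM2l a0 (hy i im)).
by rewrite le_eqVlt; apply/orP; left; apply/eqP; rewrite /interp; ring.
Qed.

(** Steps of nonnegative slope preserve the lower bound from the left; after a negative slope all
    later slopes are negative, so the right end value is a lower bound. *)
Lemma concave_ge_ends y c : concave_upto m t y -> c <= y 0%N -> c <= y m.+1 ->
  forall i, (i <= m.+1)%N -> c <= y i.
Proof.
move=> hy y0 ym.
have anti i j : (i <= j)%N -> (j <= m)%N -> slope t y j <= slope t y i.
  move=> ij jm; elim: j ij jm => [|j IH]; first by case: i.
  rewrite leq_eqVlt => /predU1P[->//|ij] jm.
  apply: le_trans (IH ij (ltnW jm)).
  by rewrite -subr_ge0 (slope_drop_ge0 _ _ tincr).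
elim=> [//|i IH]; rewrite ltnS => im.
have [s0|s0] := leP 0 (slope t y i).
  rewrite (slope_step _ _ tincr)// (le_trans (IH (leqW im)))// lerDl.
  by rewrite mulr_ge0// subr_ge0 ltW// t_lt.
apply: le_trans ym _.
suff H n : (n <= m - i)%N -> y (i.+1 + n)%N <= y i.+1.
  by have := H _ (leqnn _); rewrite addSn subnKC.
elim: n => [|n IHn] ni; first by rewrite addn0.
apply: le_trans (IHn (ltnW ni)).
have nm : (i.+1 + n <= m)%N by lia.
rewrite addnS (slope_step _ _ tincr _ _ nm) gerDl mulr_le0_ge0//.
  by apply: le_trans (ltW s0); apply: anti => //; lia.
by rewrite subr_ge0 ltW// t_lt.
Qed.

Section Tent.
Variables p q : R.
Hypothesis p0 : 0 <= p.
Hypothesis q0 : 0 <= q.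
Let tent := cap m t p 0 q.

Lemma tent_ge0 i : (i <= m.+1)%N -> 0 <= tent i.
Proof.
move=> im; rewrite /tent /cap !le_min q0 !addr0 !mulr_ge0// subr_ge0 t_le//.
Qed.

Lemma tent0 : tent 0%N = 0.
Proof.
apply/eqP; rewrite eq_le tent_ge0// andbT /tent /cap.
by rewrite !ge_min subrr mulr0 !addr0 lexx !orbT.
Qed.

Lemma tent_last : tent m.+1 = 0.
Proof.
apply/eqP; rewrite eq_le tent_ge0// andbT /tent /cap.
by rewrite !ge_min subrr mulr0 !addr0 lexx !orbT.
Qed.

Lemma tent_le i : tent i <= q.
Proof. by rewrite /tent /cap ge_min lexx. Qed.

Lemma tent_drop : slope t tent 0 - slope t tent m <= p *+ 2.
Proof.
rewrite mulr2n lerD//.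
  rewrite /slope tent0 subr0 ler_pdivrMr ?subr_gt0 ?t_lt//.
  by rewrite /tent /cap !ge_min addr0 lexx !orbT.
rewrite /slope tent_last sub0r mulNr opprK ler_pdivrMr ?subr_gt0 ?t_lt//.
by rewrite /tent /cap !ge_min !addr0 lexx !orbT.
Qed.
End Tent.

(** A tube of width a at the ends that widens with the tent is wide enough for the union bound. At
    distance s from an end the variance is at most s and (a + p s)^2 >= 2 a p s >= 4 N s; on the
    plateau the variance is at most D. *)
Lemma tent_width (p q a N D : R) i : 0 <= q -> (i < m)%N -> 0 <= a -> 0 <= N ->
  t m.+1 - t 0%N <= D ->
  4 * N * D <= q ^+ 2 -> 2 * N <= a * p ->
  N * (4 * (remaining m t i * (t i.+1 - t 0%N))) <= (a + cap m t p 0 q i.+1) ^+ 2.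
Proof.
move=> q0 im a0 N0 tD qD ap.
set X := remaining m t i * (t i.+1 - t 0%N).
have tl : 0 < t i.+1 - t 0%N.
  rewrite subr_gt0; apply: le_lt_trans (t_le 0 i _ _) (t_lt _ _) => //; lia.
have tr : 0 < t m.+1 - t i.+1.
  rewrite subr_gt0; apply: lt_le_trans (t_lt _ _) (t_le i.+2 _ _ _) => //; lia.
have tt : 0 < t m.+1 - t 0%N by lra.
have XE : X = (t m.+1 - t i.+1) * (t i.+1 - t 0%N) / (t m.+1 - t 0%N).
  by rewrite /X /remaining mulrAC.
have X1 : X <= t i.+1 - t 0%N.
  by rewrite XE ler_pdivrMr// mulrC ler_wpM2l ?(ltW tl)//; lra.
have X2 : X <= t m.+1 - t i.+1.
  by rewrite XE ler_pdivrMr// ler_wpM2l ?(ltW tr)//; lra.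
have main s : 0 <= s -> X <= s -> N * (4 * X) <= (a + p * s) ^+ 2.
  move=> s0 Xs.
  have e1 : N * X <= N * s by rewrite ler_wpM2l.
  have e2 : 2 * N * s <= a * p * s by rewrite ler_wpM2r.
  have e3 : 0 <= (a - p * s) ^+ 2 by exact: sqr_ge0.
  have e4 : 0 <= a ^+ 2 by exact: sqr_ge0.
  have e5 : 0 <= (p * s) ^+ 2 by exact: sqr_ge0.
  have -> : (a + p * s) ^+ 2 = a ^+ 2 + 2 * (a * p * s) + (p * s) ^+ 2 by ring.
  lra.
rewrite /cap !addr0.
have small : N * (4 * X) <= q ^+ 2.
  apply: le_trans qD; rewrite mulrCA mulrA ler_wpM2l//; first by rewrite mulr_ge0.
  by apply: le_trans tD; lra.
have [_|_] := leP q (Num.min (p * (t i.+1 - t 0%N)) (p * (t m.+1 - t i.+1))).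
  apply: (le_trans small); rewrite ler_pXn2r ?nnegrE ?addr_ge0 //.
  by rewrite lerDr.
by have [_|_] := leP (p * (t i.+1 - t 0%N)) (p * (t m.+1 - t i.+1)); apply: main => //; exact: ltW.
Qed.

Lemma slopeZ (a : R) y i : slope t (fun i => a * y i) i = a * slope t y i.
Proof. by rewrite /slope -mulrBr mulrA. Qed.

Variable g : R -> R.

Definition barrier (x z : R) i : R :=
  if i == 0%N then x else if i == m.+1 then z else g (t i).

Lemma barrierS x z i : (i < m)%N -> barrier x z i.+1 = g (t i.+1).
Proof. by move=> im; rewrite /barrier /= eqSS ltn_eqF. Qed.

Lemma barrier_last x z : barrier x z m.+1 = z.
Proof. by rewrite /barrier eqxx. Qed.

Variables L b : R.
Hypothesis L0 : 0 < L.
Hypothesis b0 : 0 < b.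
Hypothesis gL : forall i, (i < m)%N -> g (t i.+1) <= b * (t i.+1 - t 0%N).
Hypothesis gR : forall i, (i < m)%N -> g (t i.+1) <= b * (t m.+1 - t i.+1).

Let psi x z := least_concave m t (barrier x z).

Lemma barrier_psi_ge x z c i : (i <= m.+1)%N -> c <= x -> c <= z -> c <= psi x z i.
Proof.
move=> im cx cz; apply: concave_ge_ends => //.
- exact: least_concave_concave.
- by rewrite /psi least_concave0.
- by rewrite /psi least_concave_last// barrier_last.
Qed.

Lemma barrier_psi_drop x z : 0 <= x -> 0 <= z ->
  slope t (psi x z) 0 - slope t (psi x z) m <= b *+ 2.
Proof.
move=> x0 z0; apply: least_concave_total_drop => //.
- exact: ltW.
- by rewrite barrier_last.
- by move=> i im; rewrite barrierS// gL.
- by move=> i im; rewrite barrierS// gR.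
Qed.

Let ramp := cap m t (b / L) (-1) 0.

Let ramp_ge i : (i <= m.+1)%N -> -1 <= ramp i.
Proof.
move=> im; have bL : 0 <= b / L by rewrite divr_ge0// ltW.
by rewrite /ramp /cap !le_min oppr_le0 ler01 !lerDr !(mulr_ge0 bL) ?subr_ge0 ?t_le.
Qed.

(* Near the end points psi keeps the separation d of the end values; the ramp
   is the concave correction switching this separation off at distance L / b,
   where the barrier may reach height L. *)
Lemma barrier_psi_gap x z x' z' d : 0 <= d ->
  L <= x' -> L <= z' -> x' + d <= x -> z' + d <= z ->
  forall i, (i <= m.+1)%N -> psi x' z' i <= psi x z i + d * ramp i.
Proof.
move=> d0 x'L z'L xx zz i im.
apply: (least_concave_le _ _ _ (fun i => psi x z i + d * ramp i)) => //; split.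
  by apply: concaveD => //; [exact: least_concave_concave|exact: cap_concave].
have dr j : (j <= m.+1)%N -> - d <= d * ramp j.
  by move=> jm; rewrite -[leLHS]mulrN1 ler_wpM2l// ramp_ge.
have psi_L j : (j <= m.+1)%N -> L + d <= psi x z j.
  by move=> jm; apply: barrier_psi_ge => //; [apply: le_trans xx|apply: le_trans zz];
    rewrite lerD2r.
case=> [_|j jm].
  have := dr 0%N isT; rewrite /psi least_concave0// {1 2}/barrier /=; lra.
have [->|jm'] := eqVneq j m.
  have := dr m.+1 (leqnn _); rewrite /psi least_concave_last// !barrier_last; lra.
have {}jm' : (j < m)%N by lia.
rewrite barrierS//.
(* Where the ramp vanishes, psi majorizes g. Elsewhere an end is nearer than L / b, so g <= L, while
   psi >= L + d. *)
have [r0|r0] := eqVneq (ramp j.+1) 0.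
  by rewrite r0 mulr0 addr0 -(barrierS x z j jm'); exact: le_least_concave.
have gl : g (t j.+1) <= L.
  have : ramp j.+1 < 0.
    by rewrite lt_neqAle r0/= /ramp /cap ge_min lexx.
  rewrite /ramp /cap !gt_min ltxx/= => /orP[]; rewrite subr_lt0 => h.
    apply: le_trans (gL _ jm') _; move: h.
    by rewrite mulrAC ltr_pdivrMr// mul1r => /ltW.
  apply: le_trans (gR _ jm') _; move: h.
  by rewrite mulrAC ltr_pdivrMr// mul1r => /ltW.
have := dr _ jm; have := psi_L _ jm; lra.
Qed.

Variables p q : R.
Hypothesis p0 : 0 < p.
Hypothesis q0 : 0 < q.
Let tent := cap m t p 0 q.

(** The tent makes up for the separation that the ramp switches off: d + d ramp starts at 0 at the
    ends, rises with slope d b/L and never exceeds d. *)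
Lemma tent_ramp d i : 0 <= d -> (i <= m.+1)%N -> d <= q -> d * (b / L) <= p ->
  d <= tent i - d * ramp i.
Proof.
move=> d0 im dq dp; rewrite lerBrDr /tent /cap !le_min; apply/and3P; split.
- apply: le_trans dq; rewrite gerDl mulr_ge0_le0// /ramp /cap ge_min lexx//.
- apply: (@le_trans _ _ (d + d * (b / L * (t i - t 0%N) + -1))).
    by rewrite lerD2l ler_wpM2l// /ramp /cap !ge_min lexx !orbT.
  rewrite addr0 mulrDr mulrN1 [d * (_ * _)]mulrA addrC subrK.
  by rewrite ler_wpM2r// subr_ge0 t_le.
- apply: (@le_trans _ _ (d + d * (b / L * (t m.+1 - t i) + -1))).
    by rewrite lerD2l ler_wpM2l// /ramp /cap !ge_min lexx !orbT.
  rewrite addr0 mulrDr mulrN1 [d * (_ * _)]mulrA addrC subrK.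
  by rewrite ler_wpM2r// subr_ge0 t_le.
Qed.

(** On the plateau psi >= g and the tent adds q >= L. On the sides psi >= L and the tent rises at
    least as fast as g can. *)
Lemma barrier_psi_tent x z i : (i < m)%N -> L <= x -> L <= z -> L <= q -> b <= p ->
  g (t i.+1) + L <= psi x z i.+1 + tent i.+1.
Proof.
move=> im xL zL Lq bp.
have h1 : L <= psi x z i.+1 by apply: barrier_psi_ge => //; exact: ltnW.
have h2 : g (t i.+1) <= psi x z i.+1.
  by rewrite -(barrierS x z i im); apply: le_least_concave => //; exact: ltnW.
rewrite addrC -lerBlDl /tent /cap !le_min; apply/and3P; split.
- lra.
- have : b * (t i.+1 - t 0%N) <= p * (t i.+1 - t 0%N).
    by rewrite ler_wpM2r ?subr_ge0 ?t_le// ltnW.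
  have := gL _ im; lra.
- have : b * (t m.+1 - t i.+1) <= p * (t m.+1 - t i.+1).
    by rewrite ler_wpM2r ?subr_ge0 ?t_le// ltnW.
  have := gR _ im; lra.
Qed.

End Geometry.

(** * From the sorted points of P to grids, and auxiliary inequalities *)

Section GridOfPoints.
Context {R : realType}.
Implicit Types (l r : R) (ps : seq R).

Definition grid l r ps i : R := nth 0 (l :: rcons ps r) i.

Lemma gridS l r ps i : (i < size ps)%N -> grid l r ps i.+1 = nth 0 ps i.
Proof. by move=> im; rewrite /grid /= nth_rcons im. Qed.

Lemma grid_last l r ps : grid l r ps (size ps).+1 = r.
Proof. by rewrite /grid /= nth_rcons ltnn eqxx. Qed.

Lemma grid_increasing l r (P : seq R) : l < r -> uniq P ->
  (forall p, p \in P -> l < p < r) ->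
  increasing_upto (size (Defs.sortedP P)) (grid l r (Defs.sortedP P)).
Proof.
move=> lr uP hP; set ps := Defs.sortedP P.
have hps p : p \in ps -> l < p < r by rewrite mem_sort; exact: hP.
have : path <%R l (rcons ps r).
  rewrite rcons_path lt_path_sortedE sort_lt_sorted uP andbT.
  apply/andP; split; first by apply/allP => p /hps/andP[].
  have := mem_last l ps; rewrite inE => /predU1P[->//|/hps/andP[]//].
move=> /(pathP 0) h i im; apply: h.
by rewrite size_rcons.
Qed.

Lemma bridge_densE l r x z ps (v : nat -> R) :
  bridge_dens l r x z ps (mkseq v (size ps)) =
  chain (size ps) (grid l r ps) (fun=> 0) x z v / heat (r - l) x z.
Proof.
have pE j : (j <= (size ps).+1)%N ->
    nth 0 (x :: rcons (mkseq v (size ps)) z) j = pinned (size ps) x z v j.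
  case: j => [//|j] /=; rewrite ltnS leq_eqVlt nth_rcons size_mkseq.
  move=> /predU1P[->|js]; first by rewrite ltnn eqxx.
  by rewrite js nth_mkseq.
rewrite /bridge_dens /chain; congr (_ / _); apply: eq_bigr => -[i im] _.
by rewrite !subr0 -!pE// ltnW.
Qed.

Lemma chain_local m t s (x z : R) : local_fun m (chain m t s x z).
Proof.
move=> u v uv; apply: eq_bigr => -[i im] _ /=.
have pE j : (j <= m.+1)%N -> pinned m x z u j = pinned m x z v j.
  by case: j => [//|j] _ /=; case: ltnP => // /uv.
by rewrite -[if _ then _ else _]/(pinned m x z u i.+1)
  -[X in heat _ _ (X - _) = _]/(pinned m x z u i.+1) !pE// ltnW.
Qed.

Lemma in_tube_local m (s w : nat -> R) : local_fun m (in_tube m s w).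
Proof. by move=> u v uv; apply: eq_bigr => -[i im] _ /=; rewrite uv. Qed.

(** Since [fine] sends infinities to 0, the bounds must also force N and D to be finite. *)
Lemma fine_ratio_ge (N D : \bar R) (a b : R) : 0 < a -> 0 < b ->
  ((a * b)%:E <= N)%E -> (N <= D)%E -> (D <= a%:E)%E -> b <= fine N / fine D.
Proof.
move=> a0 b0; case: N => [N||]; case: D => [D||] //=; rewrite ?lee_fin => aN ND Da //.
have N0 : 0 < N by apply: lt_le_trans aN; rewrite mulr_gt0.
rewrite ler_pdivlMr; last exact: lt_le_trans ND.
by apply: le_trans aN; rewrite mulrC ler_wpM2r// ltW.
Qed.

Lemma last_le_of_gap (k : nat) (a : nat -> R) (e L : R) : 0 <= e -> L <= a k.-1 ->
  (forall j, (j.+1 < k)%N -> e <= a j - a j.+1) ->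
  forall j, (j < k)%N -> L <= a j.
Proof.
move=> e0 low gap j jk.
have [n jn] : exists n, j = (k.-1 - n)%N by exists (k.-1 - j)%N; lia.
rewrite {}jn; elim: n => [|n IH]; first by rewrite subn0.
have [h|h] := leqP k.-1 n.
  by have -> : (k.-1 - n.+1 = k.-1 - n)%N by lia.
have := gap (k.-1 - n.+1)%N; have -> : ((k.-1 - n.+1).+1 = k.-1 - n)%N by lia.
have hk : (k.-1 - n < k)%N by lia.
by move=> /(_ hk); move: e0 IH; lra.
Qed.

Lemma subn_step3 (k j : nat) : (j.+1 < k)%N ->
  (3 * (k - j) = 3 * (k - j.+1) + 3)%N.
Proof. by lia. Qed.

Lemma leq_mul3_subn (k j : nat) : (j < k)%N -> (3 <= 3 * (k - j))%N.
Proof. by lia. Qed.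

End GridOfPoints.

(** * The ensemble: separated tubes and bounds for the two expectations *)

Section Ensemble.
Context {R : realType}.
Variables (k : nat) (b0 b1 lam0 lam1 mu c S K : R).
Hypothesis k0 : (0 < k)%N.
Hypothesis b0_gt0 : 0 < b0.
Hypothesis b1_gt0 : 0 < b1.
Hypothesis lam0_gt0 : 0 < lam0.
Hypothesis lam1_gt0 : 0 < lam1.
Hypothesis mu_gt0 : 0 < mu.
Hypothesis c_gt0 : 0 < c.
Hypothesis c_gap : 2 * c <= (1 - mu) * lam0.
Hypothesis c_floor : c <= (1 - mu) * lam1.
Hypothesis K_lam0 : lam0 <= K.
Hypothesis K_lam1 : lam1 <= K.
Hypothesis K_b0 : 2 * b0 <= K.
Hypothesis S_b1 : b1 <= S.
Hypothesis S_lam : lam0 * (b1 / lam1) <= S.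
Hypothesis S_b0 : 2 * b0 <= c * S.

Variables (T l r : R) (am ap : nat -> R) (g : R -> R) (P : seq R).
Hypothesis T_ge : 1 <= T.
Hypothesis lr : l < r.
Hypothesis gl : g l = 0.
Hypothesis gr : g r = 0.
Hypothesis uP : uniq P.
Hypothesis P_in : forall p, p \in P -> l < p < r.
Hypothesis rl_le : r - l <= b0 * T.
Hypothesis P_le : (size P)%:R <= b0 * T.
Hypothesis g_lip : forall x y, l <= x <= r -> l <= y <= r ->
  `|g x - g y| <= b1 * T * `|x - y|.
Hypothesis am_gap : forall j, (j.+1 < k)%N -> lam0 * Num.sqrt T <= am j - am j.+1.
Hypothesis ap_gap : forall j, (j.+1 < k)%N -> lam0 * Num.sqrt T <= ap j - ap j.+1.
Hypothesis am_low : lam1 * T <= am k.-1.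
Hypothesis ap_low : lam1 * T <= ap k.-1.

Let sq := Num.sqrt T.
Let ps := Defs.sortedP P.
Let m := size ps.
Let t := grid l r ps.

Let tincr : increasing_upto m t.
Proof. exact: grid_increasing. Qed.

Let m_le : m%:R <= b0 * T.
Proof. by rewrite /m size_sort. Qed.

Let T_gt0 : 0 < T. Proof. exact: lt_le_trans T_ge. Qed.

Let sq_ge1 : 1 <= sq.
Proof. by rewrite -sqrtr1 ler_wsqrtr. Qed.

Let sq_le : sq <= T.
Proof.
by rewrite -[leRHS](sqr_sqrtr (ltW T_gt0)) -/sq expr2 ler_peMl// (le_trans ler01).
Qed.

Let sq_ge0 : 0 <= sq. Proof. exact: sqrtr_ge0. Qed.

Let t0 : t 0%N = l. Proof. by []. Qed.
Let tlast : t m.+1 = r. Proof. exact: grid_last. Qed.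

Let t_in i : (i < m)%N -> l < t i.+1 < r.
Proof.
move=> im; apply: P_in; rewrite /t gridS// -(mem_sort <=%R).
exact: mem_nth.
Qed.

Let gL i : (i < m)%N -> g (t i.+1) <= b1 * T * (t i.+1 - t 0%N).
Proof.
move=> im; have /andP[h1 h2] := t_in _ im.
have := g_lip (t i.+1) l; rewrite (ltW h1) (ltW h2) lexx (ltW lr) gl subr0.
move=> /(_ isT isT); rewrite t0 (ger0_norm (_ : 0 <= t i.+1 - l)).
  by apply: le_trans; exact: ler_norm.
by rewrite subr_ge0 ltW.
Qed.

Let gR i : (i < m)%N -> g (t i.+1) <= b1 * T * (t m.+1 - t i.+1).
Proof.
move=> im; have /andP[h1 h2] := t_in _ im.
have := g_lip (t i.+1) r; rewrite (ltW h1) (ltW h2) lexx (ltW lr) gr subr0.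
move=> /(_ isT isT); rewrite tlast distrC (ger0_norm (_ : 0 <= r - t i.+1)).
  by apply: le_trans; exact: ler_norm.
by rewrite subr_ge0 ltW.
Qed.

Let L := lam1 * T.
Let am_ge j : (j < k)%N -> L <= am j.
Proof.
apply: last_le_of_gap am_low am_gap j.
by rewrite mulr_ge0 ?sqrtr_ge0// ltW.
Qed.
Let ap_ge j : (j < k)%N -> L <= ap j.
Proof.
apply: last_le_of_gap ap_low ap_gap j.
by rewrite mulr_ge0 ?sqrtr_ge0// ltW.
Qed.
Let L_gt0 : 0 < L. Proof. by rewrite mulr_gt0. Qed.
Let b := b1 * T.
Let b_gt0 : 0 < b. Proof. by rewrite mulr_gt0. Qed.
Let p := S * T.
Let q := K * T.
Let S_gt0 : 0 < S. Proof. exact: lt_le_trans S_b1. Qed.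
Let K_gt0 : 0 < K. Proof. exact: lt_le_trans K_lam0. Qed.
Let p_gt0 : 0 < p. Proof. by rewrite mulr_gt0. Qed.
Let q_gt0 : 0 < q. Proof. by rewrite mulr_gt0. Qed.
Let tent := cap m t p 0 q.
Let ramp := cap m t (b / L) (-1) 0.
Let G j := barrier m t g (am j) (ap j).
Let psi j := least_concave m t (G j).
(** Consecutive curves differ by three tents: two absorb the tent parts of the two tube widths, the
    third yields the separation through [tent_ramp]. The lowest curve still gets three. *)
Let mult j : R := (3 * (k - j))%:R.
Let lift j i := mult j * tent i.
Let w i := c * sq + tent i.
Let center j i := psi j i + lift j i.

Let tent_ge i : (i <= m.+1)%N -> 0 <= tent i.
Proof. by move=> im; apply: tent_ge0 => //; exact: ltW. Qed.

Let tent_first : tent 0%N = 0.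
Proof. by apply: tent0 => //; exact: ltW. Qed.

Let tent_end : tent m.+1 = 0.
Proof. by apply: tent_last => //; exact: ltW. Qed.

Let mult_ge j : (j < k)%N -> 3 <= mult j.
Proof. by move=> jk; rewrite /mult ler_nat leq_mul3_subn. Qed.

Let mult_le j : mult j <= (3 * k)%:R.
Proof. by rewrite /mult ler_nat leq_mul2l leq_subr orbT. Qed.

Let d := lam0 * sq.
Let d_ge0 : 0 <= d.
Proof. by rewrite mulr_ge0 ?sqrtr_ge0// ltW. Qed.

Let tent_ramp_d i : (i <= m.+1)%N -> d <= tent i - d * ramp i.
Proof.
move=> im; apply: tent_ramp => //.
- by rewrite /d /q ler_pM ?sq_ge0 ?sq_le ?K_lam0 ?ltW.
- have -> : d * (b / L) = lam0 * (b1 / lam1) * sq.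
    by rewrite /d /b /L; field; rewrite (gt_eqF lam1_gt0) (gt_eqF T_gt0).
  by rewrite /p ler_pM ?sq_ge0 ?sq_le// mulr_ge0 ?divr_ge0 ?ltW.
Qed.

Let in_tubes v := forall j i, (j < k)%N -> (i < m)%N ->
  `|curve_val m v j i - center j i.+1| <= w i.+1.

Lemma in_tubes_floor v j i : in_tubes v -> (j < k)%N -> (i < m)%N ->
  mu * lam1 * T <= curve_val m v j i - g (t i.+1).
Proof.
move=> hv jk im; have := hv _ _ jk im; rewrite ler_norml => /andP[h1 _].
have h2 : g (t i.+1) + L <= psi j i.+1 + tent i.+1.
  apply: (@barrier_psi_tent _ m t tincr g L b) => //.
  - exact: am_ge.
  - exact: ap_ge.
  - by rewrite ler_wpM2r// ltW.
  - by rewrite ler_wpM2r// ltW.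
have h3 : 3 * tent i.+1 <= lift j i.+1.
  by rewrite ler_wpM2r ?mult_ge// tent_ge//; exact: ltnW.
have h4 : c * sq <= (1 - mu) * lam1 * T.
  by rewrite ler_pM ?sq_ge0 ?(ltW c_gt0).
have h5 : 0 <= tent i.+1 by apply: tent_ge; exact: ltnW.
by move: h1 h2; rewrite /w /center /L; lra.
Qed.

Lemma in_tubes_gap v j i : in_tubes v -> (j.+1 < k)%N -> (i < m)%N ->
  mu * lam0 * sq <= curve_val m v j i - curve_val m v j.+1 i.
Proof.
move=> hv jk im; have := hv _ _ jk im; have := hv _ _ (ltnW jk) im.
rewrite !ler_norml => /andP[h1 _] /andP[_ h2].
have h3 : psi j.+1 i.+1 <= psi j i.+1 + d * ramp i.+1.
  apply: (@barrier_psi_gap _ m t tincr g L b) => //.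
  - exact: am_ge.
  - exact: ap_ge.
  - by rewrite addrC -lerBrDr am_gap.
  - by rewrite addrC -lerBrDr ap_gap.
  - exact: ltnW.
have h4 : lift j i.+1 = lift j.+1 i.+1 + 3 * tent i.+1.
  rewrite /lift -mulrDl; congr (_ * _); by rewrite /mult -natrD (subn_step3 _ _ jk).
have h5 := tent_ramp_d i.+1 (ltnW im).
have h6 : 2 * c * sq <= (1 - mu) * lam0 * sq by rewrite ler_wpM2r ?sq_ge0.
by move: h1 h2 h3 h4 h5; rewrite /w /center /d; lra.
Qed.

Lemma in_tubes_Hev v : in_tubes v -> Hev k g P mu lam0 lam1 T v.
Proof.
move=> hv; apply/forallP => -[i im]; apply/andP; split.
  by apply/forallP => -[j jk] /=; apply/implyP => jk'; exact: in_tubes_gap.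
rewrite /= -(gridS l r _ _ im); apply: in_tubes_floor => //; by rewrite prednK.
Qed.

Lemma in_tubes_Wev v : in_tubes v -> Wev k g P v.
Proof.
move=> hv; apply/forallP => -[j jk]; apply/forallP => -[i im] /=.
rewrite -(gridS l r _ _ im) -subr_gt0.
apply: lt_le_trans (in_tubes_floor _ _ _ hv jk im).
by rewrite !mulr_gt0.
Qed.

Let bridge_heat j := heat (r - l) (am j) (ap j).
(** The factor of curve j common to the upper bound for W and the lower bound for H; it cancels in
    the ratio. *)
Let weight j := expR (- energy m t (psi j)) * heat (r - l) 0 0 / bridge_heat j.

Let bridge_heat_gt0 j : 0 < bridge_heat j.
Proof. by apply: heat_gt0; rewrite subr_gt0. Qed.

Let weight_gt0 j : 0 < weight j.
Proof.
rewrite /weight; apply: divr_gt0; last exact: bridge_heat_gt0.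
by apply: mulr_gt0; [exact: expR_gt0|apply: heat_gt0; rewrite subr_gt0].
Qed.

Let G_last j : G j m.+1 = ap j. Proof. exact: barrier_last. Qed.

(** [chain_le_majorant] bounds each curve, and the path minus psi vanishes at both ends, so the
    remaining chain integrates to the heat kernel from 0 to 0. *)
Lemma Efree_Wev_le :
  (Efree k l r am ap P (fun v => Defs.indic R (Wev k g P v)) <=
   (\prod_(j < k) weight j)%:E)%E.
Proof.
pose f j u := expR (- energy m t (psi j)) / bridge_heat j *
  chain m t (psi j) (am j) (ap j) u.
have c0 j : 0 <= expR (- energy m t (psi j)) / bridge_heat j.
  by rewrite divr_ge0 ?expR_ge0// ltW.
apply: le_trans; last first.
  apply: (@iint_prod_le _ m k f weight).
  - by move=> j u v uv; rewrite /f (chain_local _ _ _ _ _ u v).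
  - by move=> j u; rewrite mulr_ge0 ?chain_ge0.
  - by move=> j; exact: ltW.
  - move=> j jk; under [X in iint _ X]funext do rewrite /f EFinM.
    rewrite iintZl//; last by move=> u; rewrite lee_fin chain_ge0.
    rewrite iint_chain// -EFinM lee_fin t0 tlast.
    have -> : psi j 0%N = am j by rewrite /psi least_concave0.
    have -> : psi j m.+1 = ap j by rewrite /psi least_concave_last.
    by rewrite !subrr /weight mulrAC.
rewrite /Efree -/ps -/m; apply: le_iint => v.
  rewrite lee_fin mulr_ge0//; first by rewrite /Defs.indic; case: ifP.
  by apply: prodr_ge0 => j _; rewrite bridge_densE divr_ge0 ?chain_ge0// heat_ge0.
rewrite lee_fin /Defs.indic; case: ifP => hW; last first.
  by rewrite mul0r prodr_ge0// => j _; rewrite mulr_ge0 ?chain_ge0.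
rewrite mul1r; apply: ler_prod => -[j jk] _ /=.
rewrite bridge_densE divr_ge0 ?chain_ge0 ?heat_ge0//= /f mulrAC.
rewrite ler_wpM2r ?invr_ge0 ?heat_ge0//.
apply: chain_le_majorant => // i im.
rewrite /G barrierS//; apply: ltW.
move/forallP: hW => /(_ (Ordinal jk))/forallP/(_ (Ordinal im)) /=.
by rewrite /t gridS.
Qed.

(** Bounds uniform in the curve: [Mb] for lift plus width, [Hb] for the lift, [Pb] for the total
    slope drop of the lift. All are O(T), so the exponent in [cost] is O(T^2). *)
Let Mb := ((3 * k)%:R * K + K + c) * T.
Let Hb := (3 * k)%:R * K * T.
Let Pb := (3 * k)%:R * (p *+ 2).
Let cost := expR (- (b *+ 2 * Mb + Hb * Pb)) / Num.sqrt 2 ^+ m / 2.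

Let cost_gt0 : 0 < cost.
Proof. by rewrite !divr_gt0 ?expR_gt0 ?exprn_gt0 ?sqrtr_gt0. Qed.

(** The product of the tubes lies inside both events, so restricting to it only decreases the
    integral, which then factorises. *)
Lemma Efree_Hev_ge :
  ((\prod_(j < k) (weight j * cost))%:E <=
  Efree k l r am ap P (fun v => (Defs.indic R (Wev k g P v) *
     Defs.indic R (Hev k g P mu lam0 lam1 T v))%R))%E.
Proof.
pose f j u := (bridge_heat j)^-1 *
  (in_tube m (center j) w u * chain m t (fun=> 0) (am j) (ap j) u).
have c0 j : 0 <= (bridge_heat j)^-1 by rewrite invr_ge0 ltW.
apply: (@le_trans _ _ (iint (k * m)
    (fun v => (\prod_(j < k) f j (fun i => v (j * m + i)%N))%:E))).
  apply: (@iint_prod_ge _ m k f (fun j => weight j * cost)).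
  - move=> j u v uv; rewrite /f (chain_local _ _ _ _ _ u v)//.
    by rewrite (in_tube_local _ _ _ u v).
  - by move=> j u; rewrite !mulr_ge0 ?chain_ge0 ?in_tube_ge0.
  - by move=> j; rewrite mulr_ge0// ltW.
  - move=> j jk; under [X in iint _ X]funext do rewrite /f EFinM.
    rewrite iintZl//; last first.
      by move=> u; rewrite lee_fin mulr_ge0 ?chain_ge0 ?in_tube_ge0.
    have -> : (weight j * cost)%:E = ((bridge_heat j)^-1%:E *
      (expR (- energy m t (psi j)) * heat (t m.+1 - t 0%N) 0 0 * cost)%:E)%E.
      by rewrite -EFinM t0 tlast /weight; congr EFin; ring.
    apply: lee_wpmul2l; first by rewrite lee_fin.
    apply: iint_curve_ge => //.
    + apply: (@barrier_psi_drop _ m t tincr g b) => //.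
        by apply: le_trans (am_ge _ jk); exact: ltW.
      by apply: le_trans (ap_ge _ jk); exact: ltW.
    + by apply: concaveZ => //; exact: cap_concave.
    + by rewrite /lift tent_first mulr0.
    + by rewrite /lift tent_end mulr0.
    + move=> i im; rewrite /lift /Hb -mulrA ler_pM ?mult_le ?tent_le//.
      by apply: tent_ge; exact: ltnW.
    + rewrite !slopeZ -mulrBr /Pb.
      apply: (@le_trans _ _ (mult j * (p *+ 2))).
        by rewrite ler_wpM2l//; apply: tent_drop => //; exact: ltW.
      by rewrite ler_wpM2r ?mult_le// mulrn_wge0// ltW.
    + move=> i im; rewrite /lift /w /Mb.
      have e1 : mult j * tent i.+1 <= (3 * k)%:R * (K * T).
        rewrite ler_pM ?mult_le ?tent_le//.
        by apply: tent_ge; exact: ltnW.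
      have e2 : tent i.+1 <= K * T by exact: tent_le.
      have e3 : c * sq <= c * T by rewrite ler_wpM2l// ltW.
      lra.
    + by rewrite /Mb mulr_ge0 ?addr_ge0 ?mulr_ge0 ?ler0n ?(ltW K_gt0) ?(ltW c_gt0) ?(ltW T_gt0).
    + by rewrite /Hb !mulr_ge0 ?ler0n ?(ltW K_gt0) ?(ltW T_gt0).
    + move=> i im; rewrite /w ltr_pwDl ?mulr_gt0//; last first.
        by apply: tent_ge; exact: ltnW.
      exact: lt_le_trans sq_ge1.
    (* Both the number of points and the length are at most b0 T; K >= 2 b0 handles the plateau and
       c S >= 2 b0 the sides. *)
    + move=> i im; apply: (@tent_width _ m t tincr p q (c * sq) m%:R (b0 * T)) => //.
      - exact: ltW.
      - by rewrite mulr_ge0 ?sqrtr_ge0// ltW.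
      - by rewrite t0 tlast.
      - apply: (@le_trans _ _ ((2 * b0 * T) ^+ 2)).
          have -> : (2 * b0 * T) ^+ 2 = 4 * (b0 * T) * (b0 * T) by ring.
          by rewrite ler_wpM2r ?mulr_ge0 ?ler_wpM2l// ltW.
        rewrite ler_pXn2r ?nnegrE ?(ltW q_gt0)//; last first.
          by rewrite !mulr_ge0// ltW.
        by rewrite ler_wpM2r// ltW.
      - apply: (@le_trans _ _ (2 * b0 * T)).
          by rewrite -mulrA ler_wpM2l.
        have -> : c * sq * p = (c * S) * T * sq by rewrite /p; ring.
        apply: (@le_trans _ _ (c * S * T)); first by rewrite ler_wpM2r// ltW.
        by rewrite ler_peMr// !mulr_ge0// ltW.
rewrite /Efree -/ps -/m; apply: le_iint => v.
  by rewrite lee_fin prodr_ge0// => j _; rewrite !mulr_ge0 ?chain_ge0 ?in_tube_ge0.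
rewrite lee_fin.
have [hv|] := pselect (in_tubes v).
  rewrite in_tubes_Wev// in_tubes_Hev// /Defs.indic !mul1r.
  apply: ler_prod => -[j jk] _ /=.
  rewrite !mulr_ge0 ?chain_ge0 ?in_tube_ge0//= /f bridge_densE mulrC.
  rewrite ler_wpM2r//.
  rewrite ler_piMl ?chain_ge0// /in_tube prodr_ile1// => i _.
  by rewrite /Defs.indic; case: ifP; rewrite ?lexx ?ler01 ?lexx.
move=> hv.
suff -> : \prod_(j < k) f j (fun i => v (j * m + i)%N) = 0.
  rewrite !mulr_ge0//; [by rewrite /Defs.indic; case: ifP..|].
  by apply: prodr_ge0 => j _; rewrite bridge_densE divr_ge0 ?chain_ge0// heat_ge0.
move: hv => /existsNP[j /existsNP[i /not_implyP[jk /not_implyP[im /negP hji]]]].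
rewrite (bigD1 (Ordinal jk))//= {1}/f {1}/in_tube (bigD1 (Ordinal im))//=.
by rewrite {1}/Defs.indic (negbTE hji) !mul0r mulr0 mul0r.
Qed.

Lemma probL_H_ge : cost ^+ k <= probL_H k l r am ap g P mu lam0 lam1 T.
Proof.
apply: (@fine_ratio_ge _ _ _ (\prod_(j < k) weight j)).
- by apply: prodr_gt0.
- by rewrite exprn_gt0.
- suff -> : (\prod_(j < k) weight j) * cost ^+ k =
      \prod_(j < k) (weight j * cost) by exact: Efree_Hev_ge.
  by rewrite [RHS]big_split/= prodr_const card_ord.
- apply: le_iint => v; rewrite lee_fin.
    rewrite !mulr_ge0//; [by rewrite /Defs.indic; case: ifP..|].
    by apply: prodr_ge0 => j _; rewrite bridge_densE divr_ge0 ?chain_ge0// heat_ge0.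
  apply: ler_wpM2r.
    by apply: prodr_ge0 => j _; rewrite bridge_densE divr_ge0 ?chain_ge0// heat_ge0.
  by rewrite /Defs.indic; case: ifP => _; case: ifP => _; rewrite ?mulr1 ?mul0r ?mulr0.
- exact: Efree_Wev_le.
Qed.

(** The first two summands are the exponent of [cost] divided by T^2; b0 pays for the powers of sqrt
    2, of which there are at most b0 T, and 1 for the factor 1/2. *)
Definition cost_rate : R :=
  2 * b1 * ((3 * k)%:R * K + K + c) + 2 * (3 * k)%:R ^+ 2 * K * S + b0 + 1.

Lemma probL_H_ge_expR :
  expR (- (k%:R * cost_rate * T ^+ 2)) <= probL_H k l r am ap g P mu lam0 lam1 T.
Proof.
apply: le_trans probL_H_ge.
have -> : - (k%:R * cost_rate * T ^+ 2) = k%:R * - (cost_rate * T ^+ 2).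
  by ring.
rewrite expRM_natl lerXn2r ?nnegrE ?expR_ge0 ?(ltW cost_gt0)//.
have e2 : 2 <= expR 1 :> R by have := expR_ge1Dx (1 : R).
have s2 : Num.sqrt 2 ^+ m <= expR m%:R :> R.
  rewrite -[m%:R]mulr1 expRM_natl lerXn2r ?nnegrE ?expR_ge0 ?sqrtr_ge0//.
  apply: le_trans e2; rewrite -[leRHS]ger0_norm// -sqrtr_sqr ler_wsqrtr//.
  by rewrite expr2 ler_peMl// ler1n.
rewrite /cost !ler_pdivlMr ?exprn_gt0 ?sqrtr_gt0//.
apply: (@le_trans _ _ (expR (- (cost_rate * T ^+ 2)) * expR 1 * expR m%:R)).
  by rewrite !ler_pM ?mulr_ge0 ?expR_ge0 ?exprn_ge0 ?sqrtr_ge0.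
rewrite -!expRD ler_expR.
have T2 : T <= T ^+ 2 by rewrite expr2 ler_peMl// ltW.
have e1 : b0 * T <= b0 * T ^+ 2 by rewrite ler_wpM2l// ltW.
have -> : b *+ 2 * Mb + Hb * Pb =
    (cost_rate - b0 - 1) * T ^+ 2.
  by rewrite /b /Mb /Hb /Pb /p /cost_rate; ring.
by move: m_le T_ge T2 e1; lra.
Qed.

End Ensemble.

(** * Choice of the constants and conclusion *)

Theorem mainTheorem2 (R : realType) (k : nat) (b0 b1 b2 lam0 lam1 mu : R) :
  (0 < k)%N -> 0 < b0 -> 0 < b1 -> 0 < b2 -> 0 < lam0 -> 0 < lam1 ->
  0 < mu -> mu < 1 ->
  exists C : R, 0 < C /\
  forall (T l r : R) (am ap : nat -> R) (g : R -> R) (P : seq R),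
    10 <= T -> l < r ->
    g l = 0 -> g r = 0 ->
    uniq P -> (forall p, p \in P -> l < p < r) ->
    r - l <= b0 * T ->
    (size P)%:R <= b0 * T ->
    (forall x y, l <= x <= r -> l <= y <= r ->
       `|g x - g y| <= b1 * T * `|x - y|) ->
    (forall j, (j.+1 < k)%N -> lam0 * Num.sqrt T <= am j - am j.+1) ->
    (forall j, (j.+1 < k)%N -> lam0 * Num.sqrt T <= ap j - ap j.+1) ->
    lam1 * T <= am k.-1 - g l ->
    lam1 * T <= ap k.-1 - g r ->
    am 0%N - g l <= b2 * T ^+ 2 ->
    ap 0%N - g r <= b2 * T ^+ 2 ->
    C^-1 * expR (- (C * (T ^+ 2 * Num.sqrt T)))
      <= probL_H k l r am ap g P mu lam0 lam1 T.
Proof.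
move=> k0 b0_gt0 b1_gt0 _ lam0_gt0 lam1_gt0 mu_gt0 mu_lt1.
have mu' : 0 < 1 - mu by rewrite subr_gt0.
(* Two tube widths must fit into the slack (1 - mu) lam0 between curves, and one into the slack (1 -
   mu) lam1 above g. *)
pose c := Num.min ((1 - mu) * lam0 / 2) ((1 - mu) * lam1).
have c_gt0 : 0 < c by rewrite /c lt_min !mulr_gt0.
(* The tent height K T must exceed the fluctuations on the plateau, the separation and L; the slope
   S T must beat that of g and of the scaled ramp and widen the tubes fast enough. *)
pose K := 2 * b0 + lam0 + lam1.
pose S := b1 + lam0 * (b1 / lam1) + 2 * b0 / c.
have K_gt0 : 0 < K by rewrite !addr_gt0 ?mulr_gt0.
have s1 : 0 < lam0 * (b1 / lam1) by rewrite mulr_gt0 ?divr_gt0.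
have s2 : 0 < 2 * b0 / c by rewrite divr_gt0 ?mulr_gt0.
have S_gt0 : 0 < S by rewrite !addr_gt0.
pose C := k%:R * cost_rate k b0 b1 c S K + 1.
have rate_ge0 : 0 <= k%:R * cost_rate k b0 b1 c S K.
  rewrite /cost_rate; do ?[exact: ltW | exact: ler0n | apply: addr_ge0
    | apply: mulr_ge0 | apply: exprn_ge0 | done].
have C_ge1 : 1 <= C by rewrite /C lerDr.
have C_gt0 : 0 < C by exact: lt_le_trans C_ge1.
exists C; split=> // T l r am ap g P T10 lr gl gr uP P_in rl_le P_le g_lip
  am_gap ap_gap am_low ap_low _ _.
have T_ge1 : 1 <= T by apply: le_trans T10; rewrite ler1n.
(* The bound with exponent T^2 is stronger than required, because sqrt T >= 1 and C >= 1. *)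
apply: (@le_trans _ _ (expR (- (k%:R * cost_rate k b0 b1 c S K * T ^+ 2)))).
  rewrite -[leRHS]mul1r ler_pM ?invr_ge0 ?expR_ge0 ?(ltW C_gt0) ?invf_le1//.
  rewrite ler_expR lerN2 mulrA.
  have sq1 : 1 <= Num.sqrt T by rewrite -sqrtr1 ler_wsqrtr.
  apply: (@le_trans _ _ (C * T ^+ 2)).
    by rewrite ler_wpM2r ?sqr_ge0// /C lerDl.
  by rewrite ler_peMr// mulr_ge0 ?sqr_ge0// ltW.
rewrite gl subr0 in am_low; rewrite gr subr0 in ap_low.
apply: (probL_H_ge_expR k b0 b1 lam0 lam1 mu c S K) => //.
- by rewrite mulrC -ler_pdivlMr// /c ge_min lexx.
- by rewrite /c ge_min lexx orbT.
- rewrite /K; lra.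
- rewrite /K; lra.
- rewrite /K; lra.
- rewrite /S; lra.
- rewrite /S; lra.
- by rewrite [c * S]mulrC -ler_pdivrMr// /S; lra.
Qed.
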